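(* Let $(X_1,\varphi_1)$ and $(X_2,\varphi_2)$ be Cantor minimal systems. Then $\varphi_1$ and $\varphi_2$ are flip conjugated if and only if any one of the following statements holds (that is, flip conjugacy is equivalent to each of them): (1) $D([[\varphi_1]])\cong D([[\varphi_2]])$ as abstract groups; (2) $[[\varphi_1]]_0\cong [[\varphi_2]]_0$ as abstract groups; (3) $[[\varphi_1]]\cong [[\varphi_2]]$ as abstract groups.
   Context: A Cantor set is a (non-empty) zero-dimensional compact metric space without isolated points. $H(X)$ is the group of all homeomorphisms of $X$. A Cantor minimal system $(X,\varphi)$ is a Cantor set $X$ with $\varphi\in H(X)$ such that every orbit $Orb_\varphi(x)=\{\varphi^n(x):n\in\mathbb Z\}$ is dense in $X$. The full group $[\varphi]$ is the set of all $f\in H(X)$ with $f(x)\in Orb_\varphi(x)$ for all $x\in X$; for $f\in[\varphi]$ there is a cocycle $n_f:X\to\mathbb Z$ with $f(x)=\varphi^{n_f(x)}(x)$ for all $x$. The topological full group $[[\varphi]]$ is the set of all $f\in[\varphi]$ for which $n_f$ is continuous. $[[\varphi]]_0=\{\gamma\in[[\varphi]]:\int_X n_\gamma\,d\mu=0\}$, where $\mu$ is a $\varphi$-invariant Borel probability measure on $X$; this does not depend on the choice of $\mu$. For a group $G$, $D(G)$ is the commutator subgroup, generated by all $[f,g]=fgf^{-1}g^{-1}$ with $f,g\in G$. The systems $(X_1,\varphi_1)$ and $(X_2,\varphi_2)$ are flip conjugated if there is a homeomorphism $F:X_1\to X_2$ such that $F\circ\varphi_1\circ F^{-1}$ equals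 $\varphi_2$ or $\varphi_2^{-1}$. *)

(* Defs.v *)
From HB Require Import structures.
From mathcomp Require Import all_boot all_order all_algebra.
From mathcomp Require Import all_classical all_reals all_analysis.

Set Implicit Arguments.
Unset Strict Implicit.
Unset Printing Implicit Defensive.

Import Order.TTheory GRing.Theory Num.Theory.

Local Open Scope classical_set_scope.
Local Open Scope group_scope.

(* Measurable types are required to be pointed, hence so are our metric
   spaces; the base point only expresses non-emptiness. *)
#[short(type="pmetricType")]
HB.structure Definition PointedMetric (K : numDomainType) :=
  {M of Metric K M & Pointed M}.

Record homeo (X Y : topologicalType) := Homeo {
  homeo_fun :> X -> Y;
  homeo_inv : Y -> X;
  homeoK : cancel homeo_fun homeo_inv;
  homeoVK : cancel homeo_inv homeo_fun;
  homeo_continuous : continuous homeo_fun;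
  homeo_inv_continuous : continuous homeo_inv }.

Lemma homeoP (X Y : topologicalType) (f g : homeo X Y) : f =1 g -> f = g.
Proof.
move: f g => [f f' fK f'K cf cf'] [g g' gK g'K cg cg'] /= /funext fg.
move: fK f'K cf; rewrite fg => fK f'K cf.
have f'g' : f' = g' by apply/funext => y; rewrite -[in LHS](g'K y) fK.
move: fK f'K cf'; rewrite f'g' => fK f'K cf'.
by congr Homeo; exact: Prop_irrelevance.
Qed.

HB.instance Definition _ (X Y : topologicalType) := gen_eqMixin (homeo X Y).
HB.instance Definition _ (X Y : topologicalType) := gen_choiceMixin (homeo X Y).

Definition homeo_id (X : topologicalType) : homeo X X :=
  @Homeo X X id id (fun=> erefl) (fun=> erefl) (fun=> cvg_id) (fun=> cvg_id).

Definition homeo_sym (X Y : topologicalType) (f : homeo X Y) : homeo Y X :=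
  Homeo (homeoVK f) (homeoK f) (@homeo_inv_continuous _ _ f)
    (@homeo_continuous _ _ f).

Definition homeo_comp (X Y Z : topologicalType) (g : homeo Y Z)
    (f : homeo X Y) : homeo X Z :=
  @Homeo X Z (g \o f) (homeo_inv f \o homeo_inv g)
    (can_comp (homeoK g) (homeoK f)) (can_comp (homeoVK f) (homeoVK g))
    (fun x => continuous_comp (@homeo_continuous _ _ f x)
                              (@homeo_continuous _ _ g (f x)))
    (fun z => continuous_comp (@homeo_inv_continuous _ _ g z)
                              (@homeo_inv_continuous _ _ f (homeo_inv g z))).

Definition homeo_group (X : topologicalType) : Type := homeo X X.

HB.instance Definition _ (X : topologicalType) := Choice.on (homeo_group X).

Section HomeoGroup.
Variable X : topologicalType.
Implicit Types f g h : homeo_group X.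

Let mulA : associative (@homeo_comp X X X).
Proof. by move=> f g h; exact: homeoP. Qed.
Let mul1 : left_id (homeo_id X) (@homeo_comp X X X).
Proof. by move=> f; exact: homeoP. Qed.
Let mulr1 : right_id (homeo_id X) (@homeo_comp X X X).
Proof. by move=> f; exact: homeoP. Qed.
Let mulV : left_inverse (homeo_id X) (@homeo_sym X X) (@homeo_comp X X X).
Proof. by move=> f; apply: homeoP => x; exact: homeoK. Qed.
Let mulrV : right_inverse (homeo_id X) (@homeo_sym X X) (@homeo_comp X X X).
Proof. by move=> f; apply: homeoP => x; exact: homeoVK. Qed.

HB.instance Definition _ :=
  isGroup.Build (homeo_group X) mulA mul1 mulr1 mulV mulrV.
End HomeoGroup.

Section Groups.
Variable G : groupType.

Definition expgz (g : G) (n : int) : G :=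
  match n with Posz k => g ^+ k | Negz k => g ^- k.+1 end.

Definition generated_subgroup (S : set G) : set G :=
  smallest (fun H : set G => group_closed (mem H)) S.

Definition commutator_subgroup (A : set G) : set G :=
  generated_subgroup
    [set h | exists f g, [/\ A f, A g & h = f * g * f^-1 * g^-1]].
End Groups.

(* A and B are meant to be subgroups, considered as abstract groups. *)
Definition subgroup_isomorphic (G H : groupType) (A : set G) (B : set H) :=
  exists2 F : G -> H, set_bij A B F & {in A &, {morph F : x y / x * y}}.

Definition orbit (X : topologicalType) (phi : homeo_group X) (x : X) : set X :=
  range (fun n : int => expgz phi n x).

Definition cantor_minimal (K : numDomainType) (X : pmetricType K)
    (phi : homeo_group X) :=
  cantor_like X /\ forall x, dense (orbit phi x).

Definition full_group (X : topologicalType) (phi : homeo_group X) :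
    set (homeo_group X) :=
  [set f | forall x, orbit phi x (f x)].

(* The exponent is chosen arbitrarily among the suitable ones; for Cantor
   minimal systems there is only one (lemma cocycle_unique below). *)
Definition cocycle (X : topologicalType) (phi f : homeo_group X) :
    X -> discrete_topology int :=
  fun x => xget (0 : int)%R [set n : int | f x = expgz phi n x].

Definition topological_full_group (X : topologicalType)
    (phi : homeo_group X) : set (homeo_group X) :=
  [set f | full_group phi f /\ continuous (cocycle phi f)].

Definition borel (K : numDomainType) (X : pmetricType K) :=
  g_sigma_algebraType (@open X).

Definition invariant_measure (R : realType) (X : pmetricType R)
    (phi : homeo_group X) (mu : probability (borel X) R) :=
  forall A : set (borel X), measurable A -> mu (phi @^-1` A) = mu A.

Definition topological_full_group0 (R : realType) (X : pmetricType R)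
    (phi : homeo_group X) (mu : probability (borel X) R) :
    set (homeo_group X) :=
  [set f | topological_full_group phi f /\
    (\int[mu]_x ((cocycle phi f x)%:~R)%:E = 0)%E].

Definition flip_conjugate (X Y : topologicalType)
    (phi : homeo_group X) (psi : homeo_group Y) :=
  exists F : homeo X Y,
    let phiF : homeo_group Y := homeo_comp (homeo_comp F phi) (homeo_sym F) in
    phiF = psi \/ phiF = psi^-1.

Lemma homeo_mulE (X : topologicalType) (f g : homeo_group X) x :
  (f * g) x = f (g x).
Proof. by []. Qed.

Lemma cocycleP (X : topologicalType) (phi f : homeo_group X) :
  full_group phi f -> forall x, f x = expgz phi (cocycle phi f x) x.
Proof.
move=> ff x; have [n _ fn] := ff x.
by rewrite /cocycle; case: xgetP => [m _|/(_ n)] //= /(_ (esym fn)).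
Qed.

Lemma homeo_periodic_orbit (X : topologicalType) (phi : homeo_group X) x m :
  (0 < m)%N -> (phi ^+ m) x = x -> finite_set (orbit phi x).
Proof.
case: m => // m _ per.
pose S := (fun i => (phi ^+ i) x) @` `I_m.+1.
have S0 : S x by exists 0%N.
have SS y : S y -> S (phi y).
  move=> [i /= im <-]; rewrite -homeo_mulE -expgS.
  move: im; rewrite ltnS leq_eqVlt => /predU1P[->|im]; first by rewrite per.
  by exists i.+1.
have SV y : S y -> S (phi^-1 y).
  move=> [[|i] im <-].
    exists m; first exact: ltnSn.
    have -> : (phi ^+ 0) x = (phi ^+ m.+1) x by rewrite per.
    by rewrite -[RHS]homeo_mulE expgS mulKg.
  by exists i; [exact: ltnW|rewrite -[RHS]homeo_mulE expgS mulKg].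
apply: (@sub_finite_set _ _ S); last exact/finite_image/finite_II.
move=> _ [[n|n] _ <-]; rewrite /expgz.
  by elim: n => // n IHn; rewrite expgS; exact: SS.
rewrite -expVgn; elim: n.+1 => // {}n IHn.
by rewrite expgS; exact: SV.
Qed.

Lemma cantor_minimal_aperiodic (K : numDomainType) (X : pmetricType K)
    (phi : homeo_group X) x m :
  cantor_minimal phi -> (phi ^+ m) x = x -> m = 0%N.
Proof.
move=> [[/perfectTP pX _ hX _] dphi] per; apply/eqP; rewrite -leqn0 leqNgt.
apply/negP => m0; have /finite_setD fin := homeo_periodic_orbit m0 per.
have acc : accessible_space X by exact: hausdorff_accessible.
pose D := orbit phi x `\` [set x].
have oD : open (~` D).
  by apply: closed_openC; apply: (accessible_finite_set_closed.1 acc); exact: fin.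
apply: (pX x).
suff -> : [set x] = ~` D by [].
rewrite eqEsubset; split=> [_ -> [_ /(_ erefl)]//|y Dy].
apply: contrapT => yx.
have oU : open (~` (D `|` [set x])).
  apply: closed_openC; apply: (accessible_finite_set_closed.1 acc) => //.
  by rewrite finite_setU; split; [exact: fin|exact: finite_set1].
have U0 : ~` (D `|` [set x]) !=set0 by exists y => -[].
have [z [/= zU oz]] := dphi x _ U0 oU.
apply: zU; have [->|/eqP zx] := eqVneq z x; [by right|by left].
Qed.

Lemma cantor_minimal_inj (K : numDomainType) (X : pmetricType K)
    (phi : homeo_group X) x :
  cantor_minimal phi -> injective (fun n => expgz phi n x).
Proof.
move=> mphi.
have hinj (f : homeo_group X) : injective f by apply: can_inj; exact: homeoK.
have per a b y : (phi ^+ a) y = (phi ^+ b) y -> a = b.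
  wlog ab : a b / (a <= b)%N => [hw E|].
    by case: (leqP a b) => [|/ltnW] /hw ->.
  rewrite -{1}(subnKC ab) expgnDr => /esym /(hinj (phi ^+ a)).
  move=> /(cantor_minimal_aperiodic mphi) /eqP.
  by rewrite subn_eq0 => ba; apply/eqP; rewrite eqn_leq ab.
have perN a b y : (phi ^+ a) y = (phi ^- b) y -> (a + b = 0)%N.
  move=> /(congr1 (phi ^+ b)); rewrite -!homeo_mulE mulgV -expgnDr addnC.
  exact: cantor_minimal_aperiodic.
case=> [a|a] [b|b] /=.
- by move=> /per ->.
- by move=> /perN; rewrite addnS.
- by move=> /esym/perN; rewrite addnS.
- move=> E; congr Negz; apply/succn_inj.
  apply: (per _ _ ((phi ^- a.+1 * phi ^- b.+1) x)).
  have comV : commute (phi ^- a.+1) (phi ^- b.+1).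
    by rewrite /commute -!expVgn -!expgnDr addnC.
  transitivity ((phi ^- b.+1) x); first by rewrite -homeo_mulE mulVKg.
  by rewrite comV -[RHS]homeo_mulE mulVKg.
Qed.

Lemma cocycle_unique (K : numDomainType) (X : pmetricType K)
    (phi f : homeo_group X) x n :
  cantor_minimal phi -> f x = expgz phi n x -> cocycle phi f x = n.
Proof.
move=> mphi fn; apply: (cantor_minimal_inj (x := x) mphi).
rewrite /cocycle; case: xgetP => [m _ /= <- //|/(_ n)].
by move/(_ fn).
Qed.

(* Main.v *)
Require Import Defs.
From mathcomp Require Import all_boot all_order all_algebra.
From mathcomp Require Import all_classical all_reals all_analysis.
From mathcomp Require Import zify.

Set Implicit Arguments.
Unset Strict Implicit.
Unset Printing Implicit Defensive.

Import Order.TTheory GRing.Theory Num.Theory.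

Local Open Scope classical_set_scope.
Local Open Scope group_scope.

(** Every group G between the commutator subgroup of the topological full group
    and the topological full group itself determines the system up to flip
    conjugacy. The argument has two halves.

    The first recovers the space. All elements of G have clopen support, and
    five disjoint translates of a small clopen set by powers of phi can be
    permuted cyclically. Such a five-cycle is a commutator (it is conjugate to
    its square), so G contains elements of order five moving a given point and
    supported in a given neighbourhood of it (commutator_tfg_rich). For these
    elements Rubin's commutator condition alg_disjoint describes disjointness of
    supports in terms of the group law, whence inclusion of supports is a
    group-theoretic notion (alg_subP). By compactness points can be read off
    from the ordered set of supports, and every isomorphism is conjugation by a
    homeomorphism (spatial_isomorphism). Since phi coincides near each point
    with a five-cycle in G, the homeomorphism identifies the two systems with
    two minimal homeomorphisms phi and psi of one space, each in the topological
    full group of the other (isomorphism_same_tfg).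

    The second is a theorem of Boyle. Write phi^k x = psi^(a k x) x. The function
    k |-> a k x is a bijection of the integers with steps bounded in both
    directions, so it has a definite sign for large k, and by minimality the
    sign does not depend on x (cocycle_sign). Replacing psi by its inverse if
    necessary, the forward orbits of x under phi and psi differ in finitely many
    points; moving each x along its orbit by the index of these two sets
    conjugates phi to psi (positive_conjugate).

    Conversely, a flip conjugacy clearly carries topological full groups and
    their commutator subgroups to each other. For the groups defined by the
    vanishing of the integral of the cocycle one needs that this condition does
    not depend on the invariant measure: the integral equals the flux, the index
    of the forward orbit of a point relative to its preimage, a constant defined
    without measures (integral_cocycle). The flux is also a homomorphism, so
    these groups contain the commutators. *)

(** * Homeomorphisms and their supports *)

Section HomeoFacts.
Variable X : topologicalType.
Implicit Types f g h : homeo_group X.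

Lemma homeo_inj f : injective f.
Proof. exact: can_inj (homeoK f). Qed.

Lemma homeo_mulKE f x : f^-1 (f x) = x.
Proof. exact: homeoK. Qed.

Lemma homeo_mulVKE f x : f (f^-1 x) = x.
Proof. exact: homeoVK. Qed.

Definition supp f : set X := [set x | f x <> x].

Lemma suppE f x : supp f x = (f x <> x).
Proof. by []. Qed.

Lemma suppPn f x : ~ supp f x -> f x = x.
Proof. by move=> /contrapT. Qed.

Lemma homeo_eq1 f : (forall x, f x = x) -> f = 1.
Proof. by move=> f1; apply: homeoP => x; rewrite f1. Qed.

Lemma homeo_neq1 f : f <> 1 -> exists x, supp f x.
Proof.
move=> f1; apply: contrapT => nf; apply: f1; apply: homeo_eq1 => x.
by apply: suppPn => fx; apply: nf; exists x.
Qed.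

Lemma supp_image f x : supp f x -> supp f (f x).
Proof. by move=> fx /homeo_inj. Qed.

Lemma commuteE f g x : commute f g -> f (g x) = g (f x).
Proof. by move=> fg; rewrite -!homeo_mulE fg. Qed.

Lemma disjoint_supp_commute f g :
  (forall x, supp f x -> supp g x -> False) -> commute f g.
Proof.
move=> dfg; apply: homeoP => x; rewrite !homeo_mulE.
have [fx|/suppPn fx] := pselect (supp f x).
  have /suppPn-> : ~ supp g x by move=> gx; exact: dfg fx gx.
  by have /suppPn-> : ~ supp g (f x) by move=> gx; exact: dfg (supp_image fx) gx.
rewrite fx; have [gx|/suppPn->//] := pselect (supp g x).
by apply: suppPn => fgx; exact: dfg fgx (supp_image gx).
Qed.

Lemma supp_expg f n x : (f ^+ n) x <> x -> supp f x.
Proof.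
move=> fn fx; apply: fn; elim: n => // n IHn.
by rewrite expgSr homeo_mulE fx.
Qed.

Lemma supp_conj f g x : supp (f * g * f^-1) x <-> supp g (f^-1 x).
Proof.
rewrite !suppE !homeo_mulE; split=> [H E|H E]; apply: H.
  by rewrite E homeo_mulVKE.
by rewrite -[in RHS]E homeo_mulKE.
Qed.

Lemma homeo_commgE f g x : [~ f, g] x = f^-1 (g^-1 (f (g x))).
Proof. by rewrite /commg /conjg !homeo_mulE. Qed.

Lemma supp_commg f g x :
  supp [~ f, g] x -> supp g x \/ supp g (f x).
Proof.
move=> fgx; apply: contrapT => /not_orP[/suppPn gx /suppPn gfx]; apply: fgx.
rewrite homeo_commgE gx.
by rewrite -[in (g^-1) _]gfx homeo_mulKE homeo_mulKE.
Qed.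

Lemma supp_inv f x : supp f^-1 x <-> supp f x.
Proof.
rewrite !suppE; split=> H E; apply: H; first by rewrite -[in LHS]E homeo_mulKE.
by rewrite -[in LHS]E homeo_mulVKE.
Qed.

Lemma supp_stable f (V : set X) y : supp f `<=` V -> V y -> V (f y).
Proof.
move=> fV Vy; apply: contrapT => nV; apply: (nV).
by have /suppPn/homeo_inj-> : ~ supp f (f y) by move/fV.
Qed.

Lemma clopen_homeo_preimage f (U : set X) : clopen U -> clopen (f @^-1` U).
Proof.
move=> cU; apply: clopen_comp => // x; exact: homeo_continuous.
Qed.

End HomeoFacts.

Definition stone_space (X : topologicalType) :=
  [/\ compact [set: X], hausdorff_space X & zero_dimensional X].

Section Stone.
Variable X : topologicalType.
Hypothesis stX : stone_space X.
Implicit Types f g h : homeo_group X.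

Lemma clopen_basis (U : set X) x :
  nbhs x U -> exists V, [/\ clopen V, V x & V `<=` U].
Proof.
move=> nU; have [cX hX zX] := stX.
have [V [Vx cV] VU] := zero_dimensional_cvg hX zX cX nU.
by exists V.
Qed.

Lemma clopen_open (U : set X) : clopen U -> open U.
Proof. by case. Qed.

Lemma clopen_nbhs (U : set X) x : clopen U -> U x -> nbhs x U.
Proof. by move=> [oU _] Ux; exact: open_nbhs_nbhs. Qed.

(** Applied to the powers of an element of order five, or to the differences of
    return times of a point, this yields clopen sets with pairwise disjoint
    translates. *)
Lemma clopen_displaced (s : seq (homeo_group X)) (U : set X) x :
    nbhs x U -> (forall h, h \in s -> h x <> x) ->
  exists V, [/\ clopen V, V x, V `<=` U &
                forall h y, h \in s -> V y -> ~ V (h y)].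
Proof.
move=> nU; elim: s => [|h s IHs] hs.
  by have [V [cV Vx VU]] := clopen_basis nU; exists V; split.
have [|V [cV Vx VU sV]] := IHs; first by move=> k ks; apply: hs; rewrite inE ks orbT.
have [_ _ zX] := stX.
have /eqP/zX[W [cW Wx Whx]] : x <> h x.
  by move=> /esym; apply: hs; rewrite inE eqxx.
exists (V `&` W `&` h @^-1` (~` W)); split.
- apply: clopenI; first exact: clopenI.
  by apply: clopen_homeo_preimage; exact: clopenC.
- by [].
- by move=> y [[/VU]].
- move=> k y; rewrite inE => /predU1P[->|ks] [[Vy Wy] hy] [[Vk Wk] hk] //.
  exact: sV ks Vy Vk.
Qed.

End Stone.

(** * Recovering the support order from the group structure *)

Section AlgebraicDisjointness.
Variables (G : groupType) (A : set G).
Implicit Types f g h : G.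

(** Rubin's algebraic substitute for disjointness of supports. Where h moves
    points of the support of f there is room for two elements f1, f2 whose
    double commutator with h reduces to a commutator of f1 and f2, hence stays
    away from g when the support of g is elsewhere. *)
Definition alg_disjoint f g := forall h, A h -> ~ commute f h ->
  exists f1 f2, [/\ A f1, A f2, commute f1 g, commute f2 g &
    [~ f1, [~ f2, h]] <> 1 /\ commute [~ f1, [~ f2, h]] g].

(** The support of f is the complement of the union of the supports of the
    elements of order five that are disjoint from f, so this expresses inclusion
    of the support of h in that of f. *)
Definition alg_sub h f := forall g, A g -> g ^+ 5 = 1 ->
  alg_disjoint f g -> alg_disjoint h g.

End AlgebraicDisjointness.

(** The order five ensures that every nontrivial orbit of g has five points:
    one more than the number of translates of a small set that can support a
    double commutator. *)
Definition rich (X : topologicalType) (A : set (homeo_group X)) :=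
  forall (U : set X) x, clopen U -> U x ->
    exists g, [/\ A g, g ^+ 5 = 1, supp g x & supp g `<=` U].

Section RichGroups.
Variables (X : topologicalType) (A : set (homeo_group X)).
Hypotheses (stX : stone_space X) (richA : rich A).
Hypothesis clopen_supp : forall f, A f -> clopen (supp f).
Implicit Types f g h : homeo_group X.

(** If f and h do not commute then h moves some point x of the support of f.
    Small elements f2, and then f1 with support so small that f1 fixes f2 x, do
    not commute, and their supports lie in that of f, hence off that of g. *)
Lemma alg_disjoint_of_supp f g : A f ->
  (forall x, supp f x -> supp g x -> False) -> alg_disjoint A f g.
Proof.
move=> Af fg h Ah nfh.
have [x [fx hx]] : exists x, supp f x /\ supp h x.
  apply: contrapT => nx; apply: nfh; apply: disjoint_supp_commute => x fx hx.
  by apply: nx; exists x.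
have [|V [cV Vx Vf Vh]] := @clopen_displaced _ stX [:: h] _ x
    (clopen_nbhs (clopen_supp Af) fx).
  by move=> k; rewrite inE => /eqP ->.
have hV y : V y -> ~ V (h y) by apply: Vh; rewrite inE.
have [f2 [Af2 _ f2x f2V]] := richA cV Vx.
have [|V1 [cV1 V1x V1V V1f2]] := @clopen_displaced _ stX [:: f2] _ x
    (clopen_nbhs cV Vx).
  by move=> k; rewrite inE => /eqP ->.
have [f1 [Af1 _ f1x f1V1]] := richA cV1 V1x.
have f1V y : ~ V y -> f1 y = y by move=> Vy; apply: suppPn => /f1V1/V1V.
have f2V' y : ~ V y -> f2 y = y by move=> Vy; apply: suppPn => /f2V.
have f2VV y : V y -> V (f2 y) by exact: supp_stable.
have comm k : supp k `<=` V -> commute k g.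
  by move=> kV; apply: disjoint_supp_commute => z /kV/Vf; exact: fg.
have c1 : commute f1 g by apply: comm => y /f1V1/V1V.
have c2 : commute f2 g by exact: comm.
have f2NV : supp f2^-1 `<=` V by move=> y /supp_inv/f2V.
have f2VN y : ~ V y -> f2^-1 y = y by move=> Vy; apply: suppPn => /f2NV.
have f2VVV y : V y -> V (f2^-1 y) by exact: supp_stable.
(* The commutator with h acts on V as the inverse of f2: the other factor is
   carried by the disjoint set that h maps to V. *)
have qV y : V y -> [~ f2, h] y = f2^-1 y.
  move=> Vy; rewrite homeo_commgE (f2V' (h y)) ?homeo_mulKE //.
  exact: hV.
have qNV y : ~ V y -> ~ V ([~ f2, h] y).
  move=> Vy; set z := [~ f2, h] y => Vz.
  have : [~ f2, h] (f2 z) = z by rewrite qV ?homeo_mulKE //; exact: f2VV.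
  by move=> /homeo_inj E; apply: Vy; rewrite -E; exact: f2VV.
have kE : [~ f1, [~ f2, h]] = [~ f1, f2^-1].
  apply: homeoP => y; rewrite !(homeo_commgE f1) invgK.
  have [Vy|Vy] := pselect (V y).
    have V3 : V (f1 (f2^-1 y)).
      by apply: supp_stable; [move=> z /f1V1/V1V|exact: f2VVV].
    congr (f1^-1 _); rewrite qV //.
    apply: (@homeo_inj _ [~ f2, h]); rewrite homeo_mulVKE qV ?homeo_mulKE //.
    exact: f2VV.
  have f2y := f2VN _ Vy; rewrite f2y (f1V y) // (f2V' y) //.
  by congr (f1^-1 _); rewrite f1V ?homeo_mulKE //; exact: qNV.
exists f1, f2; split => //; rewrite kE; split.
  move=> /eqP/commgP/commuteV; rewrite invgK => c12.
  have := commuteE x c12; rewrite (suppPn (x := f2 x)); last first.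
    by move=> /f1V1; apply: V1f2 => //; rewrite inE.
  by move=> /homeo_inj/esym.
apply: commute_sym; rewrite /commg /conjg; have := commute_sym c1.
have := commute_sym c2 => g2 g1.
have g1V := commuteV g1; have g2V := commuteV g2.
by do ![apply: commuteM => //]; rewrite invgK.
Qed.
End RichGroups.

Section PeriodicDisjointness.
Variables (X : topologicalType) (A : set (homeo_group X)).
Hypotheses (stX : stone_space X) (richA : rich A).
Hypothesis clopen_supp : forall f, A f -> clopen (supp f).
Implicit Types f g h : homeo_group X.

Lemma expg_fixed_coprime g n m x : coprime n m -> (0 < n)%N ->
  (g ^+ n) x = x -> (g ^+ m) x = x -> g x = x.
Proof.
move=> co n0 gn gm.
have per k l y : (g ^+ k) y = y -> (g ^+ (k * l)) y = y.
  by rewrite expgnA => gk; apply: suppPn => /supp_expg /=; rewrite suppE gk.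
have [a b ab _] := egcdnP m n0.
move: ab; rewrite (eqP co) => ab.
have := per _ a _ gn; rewrite mulnC ab addnC expgnDr expg1 homeo_mulE mulnC.
by rewrite per.
Qed.

(** Suppose f and g both move x, take V around x displaced by f and by the
    nontrivial powers of g, and h supported in V. Then f and h do not commute,
    and the resulting double commutator commutes with g, so its support contains
    five iterates of some point under g. That support lies in four translates of
    V by elements commuting with g, and none of them contains two of the
    iterates. *)
Lemma supp_of_alg_disjoint f g : A f -> g ^+ 5 = 1 ->
  alg_disjoint A f g -> forall x, supp f x -> supp g x -> False.
Proof.
move=> Af g5 fg x fx gx.
have gi i : (0 < i < 5)%N -> (g ^+ i) x <> x.
  move=> i5 gix; apply: gx; apply: (@expg_fixed_coprime _ 5 i) => //.
    by move: i i5 {gix} => [|[|[|[|[|]]]]].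
  by rewrite g5.
have [|V [cV Vx Vf Vh]] := @clopen_displaced _ stX
    (f :: [seq g ^+ i | i <- iota 1 4]) _ x (clopen_nbhs (clopen_supp Af) fx).
  move=> k; rewrite inE => /predU1P[->//|/mapP[i]].
  by rewrite mem_iota => i5 ->; exact: gi.
have fV y : V y -> ~ V (f y) by apply: Vh; rewrite inE eqxx.
have gV i y : (0 < i < 5)%N -> V y -> ~ V ((g ^+ i) y).
  by move=> i5; apply: Vh; rewrite inE map_f ?orbT// mem_iota.
have [h [Ah _ hx hV]] := richA cV Vx.
have nfh : ~ commute f h.
  move=> /(commuteE x); rewrite [RHS]suppPn; last by move=> /hV; exact: fV.
  by move=> /homeo_inj.
have [f1 [f2 [Af1 Af2 c1 c2 [k1 kg]]]] := fg h Ah nfh.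
set k := [~ f1, [~ f2, h]] in k1 kg.
have [z kz] := homeo_neq1 k1.
(* The translates of V containing the support of k, indexed by the four ways to
   unfold the two commutators. *)
pose w (b : bool * bool) : homeo_group X :=
  (if b.1 then f2 else 1) * (if b.2 then f1 else 1).
have wg b i : commute (w b) (g ^+ i).
  apply: commuteX; apply: commute_sym; apply: commuteM.
    by case: b.1; [exact: commute_sym|exact: commute1].
  by case: b.2; [exact: commute_sym|exact: commute1].
have kw y : supp k y -> exists b, V (w b y).
  case/supp_commg=> /supp_commg[] /hV Vy.
  - by exists (false, false); rewrite /w !homeo_mulE.
  - by exists (true, false); rewrite /w !homeo_mulE.
  - by exists (false, true); rewrite /w !homeo_mulE.
  - by exists (true, true); rewrite /w !homeo_mulE.
have kgi i : supp k ((g ^+ i) z).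
  by move=> E; apply: kz; apply: (@homeo_inj _ (g ^+ i));
     rewrite -[RHS]E (commuteE _ (commuteX i kg)).
have [b Vb] := choice (fun i : 'I_5 => kw _ (kgi i)).
(* Five iterates and only four translates: two iterates share one. *)
have : ~ injective b.
  by move=> /leq_card; rewrite card_ord card_prod card_bool.
apply=> i j; wlog ij : i j / (i <= j)%N => [hw bij|bij].
  by case: (leqP i j) => [|/ltnW] /hw ->.
apply/eqP; apply: contrapT => /negP nij.
have i5 : (0 < j - i < 5)%N.
  rewrite subn_gt0 ltn_neqAle nij ij /=.
  by apply: leq_ltn_trans (ltn_ord j); rewrite leq_subr.
apply: (gV _ _ i5 (Vb i)); rewrite -(commuteE _ (wg _ _)) -homeo_mulE.
rewrite -homeo_mulE -mulgA -expgnDr subnK // bij homeo_mulE.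
exact: Vb.
Qed.

Lemma alg_subP h f : A h -> A f ->
  supp h `<=` supp f <-> alg_sub A h f.
Proof.
move=> Ah Af; split=> [hf g Ag g5 fg|hf x hx].
  apply: alg_disjoint_of_supp => // x /hf fx; move: fx.
  exact: supp_of_alg_disjoint fg x.
apply: contrapT => fx.
have [g [Ag g5 gx gf]] := richA (clopenC setT (clopen_supp Af)) fx.
apply: (@supp_of_alg_disjoint h g) hx gx => //.
apply: hf => //; apply: alg_disjoint_of_supp => // y fy /gf; exact.
Qed.

End PeriodicDisjointness.

Definition subgroup (G : groupType) (A : set G) :=
  [/\ A 1, forall f g, A f -> A g -> A (f * g) & forall f, A f -> A f^-1].

Section SubgroupIsomorphism.
Variables (G H : groupType) (A : set G) (B : set H) (F : G -> H).
Hypotheses (sA : subgroup A) (FAB : set_bij A B F).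
Hypothesis FM : {in A &, {morph F : x y / x * y}}.
Implicit Types f g h : G.

Let A1 : A 1. Proof. by case: sA. Qed.
Let AM f g : A f -> A g -> A (f * g). Proof. by case: sA => _ + _; exact. Qed.
Let AV f : A f -> A f^-1. Proof. by case: sA => _ _; exact. Qed.

Let FMA f g : A f -> A g -> F (f * g) = F f * F g.
Proof. by move=> Af Ag; rewrite FM ?inE. Qed.

Lemma iso_sub f : A f -> B (F f).
Proof. by case: FAB => + _ _; exact. Qed.

Lemma iso_inj f g : A f -> A g -> F f = F g -> f = g.
Proof. by move=> Af Ag; case: FAB => _ Fi _ /Fi; apply; rewrite inE. Qed.

Lemma iso_surj k : B k -> exists2 f, A f & F f = k.
Proof. by case: FAB => _ _ + => /[apply]. Qed.

Lemma iso1 : F 1 = 1.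
Proof. by apply: (mulgI (F 1)); rewrite -FMA // !mulg1. Qed.

Lemma isoV f : A f -> F f^-1 = (F f)^-1.
Proof.
move=> Af; apply: (mulgI (F f)).
by rewrite -FMA ?mulgV ?iso1 //; exact: AV.
Qed.

Lemma isoX f n : A f -> A (f ^+ n) /\ F (f ^+ n) = F f ^+ n.
Proof.
move=> Af; elim: n => [|n [An IHn]]; first by rewrite !expg0 iso1.
by rewrite !expgS FMA // IHn; split=> //; exact: AM.
Qed.

Lemma subgroup_commg f g : A f -> A g -> A [~ f, g].
Proof. by move=> Af Ag; do ![apply: AM|apply: AV|done]. Qed.

Lemma iso_commg f g : A f -> A g -> F [~ f, g] = [~ F f, F g].
Proof.
move=> Af Ag; have AVf := AV Af; have AVg := AV Ag.
by rewrite /commg /conjg !(FMA, isoV) //; do ?apply: AM.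
Qed.

Lemma iso_conj f g : A f -> A g ->
  A (f * g * f^-1) /\ F (f * g * f^-1) = F f * F g * (F f)^-1.
Proof.
move=> Af Ag; have AVf := AV Af; have Afg := AM Af Ag.
by rewrite !(FMA, isoV) //; split => //; exact: AM.
Qed.

Lemma iso_commute f g : A f -> A g -> commute f g <-> commute (F f) (F g).
Proof.
move=> Af Ag; rewrite /commute -!FMA //; split=> [->//|].
by move/iso_inj; apply; exact: AM.
Qed.

Lemma iso_alg_disjoint f g : A f -> A g ->
  alg_disjoint A f g <-> alg_disjoint B (F f) (F g).
Proof.
move=> Af Ag; split=> fg.
  move=> _ /iso_surj[h Ah <-] nfh.
  have [|f1 [f2 [Af1 Af2 c1 c2 [k1 kg]]]] := fg h Ah.
    by apply: contra_not nfh => /iso_commute; apply.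
  have A2 := subgroup_commg Af2 Ah; have A12 := subgroup_commg Af1 A2.
  exists (F f1), (F f2); rewrite -!iso_commg //.
  split; [exact: iso_sub|exact: iso_sub|exact/iso_commute|exact/iso_commute|].
  split; last exact/iso_commute.
  by rewrite -iso1 => /iso_inj k1'; apply: k1; exact: k1'.
move=> h Ah nfh.
have [||k1 [k2 [/iso_surj[f1 Af1 <-] /iso_surj[f2 Af2 <-]]]] := fg (F h).
- exact: iso_sub.
- by apply: contra_not nfh => /iso_commute; apply.
have A2 := subgroup_commg Af2 Ah; have A12 := subgroup_commg Af1 A2.
rewrite -!iso_commg // => /iso_commute c1 /iso_commute c2 [k1' /iso_commute kg].
exists f1, f2; split; [by []|by []|exact: c1|exact: c2|].
by split; [move=> k; apply: k1'; rewrite k iso1|exact: kg].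
Qed.

Lemma iso_alg_sub h f : A h -> A f ->
  alg_sub A h f <-> alg_sub B (F h) (F f).
Proof.
move=> Ah Af; split=> hf.
  move=> _ /iso_surj[g Ag <-] g5 /(iso_alg_disjoint Af Ag) fg.
  apply/(iso_alg_disjoint Ah Ag); apply: hf => //.
  have [A5 E5] := isoX 5 Ag; apply: iso_inj => //.
  by rewrite E5 iso1.
move=> g Ag g5 /(iso_alg_disjoint Af Ag) fg; apply/(iso_alg_disjoint Ah Ag).
apply: hf => //; first exact: iso_sub.
by have [_ <-] := isoX 5 Ag; rewrite g5 iso1.
Qed.

End SubgroupIsomorphism.

Lemma subgroup_isomorphic_inv (G H : groupType) (A : set G) (B : set H)
    (F : G -> H) :
    subgroup A -> set_bij A B F -> {in A &, {morph F : x y / x * y}} ->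
  exists F' : H -> G, [/\ set_bij B A F', {in B &, {morph F' : x y / x * y}},
    {in A, cancel F F'} & {in B, cancel F' F}].
Proof.
move=> sA FAB FM; have AB := iso_sub FAB.
have Fs := iso_surj FAB; have Fi := iso_inj FAB.
have FMA f g : A f -> A g -> F (f * g) = F f * F g.
  by move=> Af Ag; rewrite FM ?inE.
have [A1 AM AV] := sA.
have /choice[F' F'P] k : exists f, B k -> A f /\ F f = k.
  have [/Fs[f Af <-]|nB] := pselect (B k); first by exists f.
  by exists 1 => /nB.
have F'A k : B k -> A (F' k) by move=> /F'P[].
have F'K k : B k -> F (F' k) = k by move=> /F'P[].
have FK f : A f -> F' (F f) = f.
  by move=> Af; apply: Fi; rewrite ?F'K //; [apply: F'A|]; exact: AB.
exists F'; split.
- split=> [k|k l /set_mem Bk /set_mem Bl E|f Af]; first exact: F'A.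
    by rewrite -(F'K k) // E F'K.
  by exists (F f); [exact: AB|exact: FK].
- move=> k l /set_mem Bk /set_mem Bl.
  by rewrite -{1}(F'K k) // -{1}(F'K l) // -FMA ?FK //; do ?apply: AM; exact: F'A.
- by move=> f /set_mem; exact: FK.
- by move=> k /set_mem; exact: F'K.
Qed.

(** * Spatial realization of isomorphisms *)

Section SpatialRelation.
Variables (X Y : topologicalType).
Variables (A : set (homeo_group X)) (B : set (homeo_group Y)).
Variable F : homeo_group X -> homeo_group Y.
Hypotheses (stX : stone_space X) (stY : stone_space Y).
Hypotheses (richA : rich A) (richB : rich B).
Hypothesis clopenA : forall f, A f -> clopen (supp f).
Hypothesis clopenB : forall f, B f -> clopen (supp f).
Hypotheses (sA : subgroup A) (FAB : set_bij A B F).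
Hypothesis FM : {in A &, {morph F : x y / x * y}}.
Implicit Types f g h : homeo_group X.

Definition corresponds (x : X) (y : Y) :=
  forall g, A g -> supp g x <-> supp (F g) y.

Lemma iso_supp_sub h f : A h -> A f ->
  supp h `<=` supp f <-> supp (F h) `<=` supp (F f).
Proof.
move=> Ah Af; rewrite (alg_subP stX richA) //.
rewrite (alg_subP stY richB clopenB) ?(iso_alg_sub sA FAB) //.
  exact: iso_sub FAB _ Ah.
exact: iso_sub FAB _ Af.
Qed.

(** A common point of two supports gives, by richness, a nontrivial element
    whose support is below both; its preimage under F contradicts the
    disjointness upstairs. *)
Lemma iso_supp_disjoint f g y : A f -> A g ->
  (forall x, supp f x -> supp g x -> False) ->
  supp (F f) y -> supp (F g) y -> False.
Proof.
move=> Af Ag fg Ffy Fgy.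
have cI : clopen (supp (F f) `&` supp (F g)).
  by apply: clopenI; apply: clopenB; exact: iso_sub FAB _ _.
have [k [Bk _ ky kI]] := richB cI (conj Ffy Fgy).
have [h Ah hk] := iso_surj FAB Bk.
have hf : supp h `<=` supp f by apply/iso_supp_sub => // z; rewrite hk => /kI[].
have hg : supp h `<=` supp g by apply/iso_supp_sub => // z; rewrite hk => /kI[].
move: ky; rewrite -hk (_ : h = 1) ?(iso1 sA FM) //.
by apply: homeo_eq1 => z; apply: suppPn => /[dup] /hf; move/fg => + /hg.
Qed.

(** The supports of the images of the elements moving x form a filter base of
    closed sets, because by richness the supports of two elements moving x both
    contain the support of a third one; a cluster point of the base is the
    required y. *)
Lemma corresponds_exists x : exists y, corresponds x y.
Proof.
have [cY _ _] := stY.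
pose D : set (homeo_group X) := [set g | A g /\ supp g x].
pose Fx := filter_from D (fun g => supp (F g)).
have [g0 [Ag0 _ g0x _]] := richA clopenT (I : setT x).
have FFx : ProperFilter Fx.
  apply: filter_from_proper.
    apply: filter_from_filter; first by exists g0.
    move=> f g [Af fx] [Ag gx].
    have [h [Ah _ hx hI]] :=
      richA (clopenI (clopenA Af) (clopenA Ag)) (conj fx gx).
    exists h => //; rewrite subsetI.
    by split; apply/iso_supp_sub => // z /hI[].
  move=> g [Ag gx]; apply: contrapT => ng; apply: gx.
  suff -> : g = 1 by [].
  apply: (iso_inj FAB) => //; first by case: sA.
  rewrite (iso1 sA FM); apply: homeo_eq1 => y.
  by apply: suppPn => gy; apply: ng; exists y.
have [y [_ yF]] := cY _ FFx filterT.
have xy g : A g -> supp g x -> supp (F g) y.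
  move=> Ag gx; have [_ /closure_id ->] := clopenB (iso_sub FAB Ag).
  by move: yF; rewrite clusterE; apply; exists g.
exists y => g Ag; split; first exact: xy.
move=> gy; apply: contrapT => gx.
have [h [Ah _ hx hg]] := richA (clopenC setT (clopenA Ag)) gx.
by apply: (iso_supp_disjoint Ah Ag _ (xy _ Ah hx) gy) => z /hg.
Qed.

Lemma corresponds_uniq x y y' : corresponds x y -> corresponds x y' -> y = y'.
Proof.
move=> xy xy'; apply: contrapT => /eqP yy'.
have [_ _ zY] := stY; have [U [cU Uy Uy']] := zY _ _ yy'.
have [k [Bk _ ky kU]] := richB cU Uy.
have [h Ah hk] := iso_surj FAB Bk.
by apply/Uy'/kU; rewrite -hk; apply/xy' => //; apply/xy => //; rewrite hk.
Qed.

Lemma corresponds_image x y g : A g -> corresponds x y ->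
  corresponds (g x) (F g y).
Proof.
move=> Ag xy f Af; have [A1 AM AV] := sA; have AVg := AV _ Ag.
have [Ac Ec] := iso_conj sA FM AVg Af.
by have := xy _ Ac; rewrite Ec !supp_conj (isoV sA FM).
Qed.

End SpatialRelation.

(** A point is determined by the set of group elements that move it, and these
    sets are described by the order on supports, which the isomorphism respects.
    The correspondence of points is symmetric in F and its inverse, so it gives
    two mutually inverse maps, both continuous since supports form a base. *)
Theorem spatial_isomorphism (X Y : topologicalType)
    (A : set (homeo_group X)) (B : set (homeo_group Y))
    (F : homeo_group X -> homeo_group Y) :
    stone_space X -> stone_space Y -> rich A -> rich B ->
    (forall f, A f -> clopen (supp f)) -> (forall f, B f -> clopen (supp f)) ->
    subgroup A -> subgroup B ->
    set_bij A B F -> {in A &, {morph F : x y / x * y}} ->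
  exists L : homeo X Y, forall g, A g -> forall x, F g (L x) = L (g x).
Proof.
move=> stX stY rA rB cA cB sA sB FAB FM.
have [F' [F'BA F'M FK F'K]] := subgroup_isomorphic_inv sA FAB FM.
have [L LP] := choice (corresponds_exists stX stY rA rB cA cB sA FAB FM).
have [L' L'P] := choice (corresponds_exists stY stX rB rA cB cA sB F'BA F'M).
have corrV y : corresponds A F (L' y) y.
  move=> g Ag; rewrite -[in X in X <-> _](FK g) ?inE //.
  by apply: iff_sym; apply: L'P; exact: iso_sub FAB _ Ag.
have corrV' x : corresponds B F' (L x) x.
  move=> k Bk; rewrite -[in X in X <-> _](F'K k) ?inE //.
  by apply: iff_sym; apply: LP; exact: iso_sub F'BA _ Bk.
have LK : cancel L L'.
  by move=> x; apply: (corresponds_uniq stX rA F'BA) (L'P (L x)) (corrV' x).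
have L'K : cancel L' L.
  by move=> y; apply: (corresponds_uniq stY rB FAB) (LP (L' y)) (corrV y).
have cont (Z W : topologicalType) (C : set (homeo_group Z))
    (D : set (homeo_group W)) (E : homeo_group Z -> homeo_group W)
    (M : Z -> W) : stone_space W -> rich D ->
    (forall f, C f -> clopen (supp f)) -> set_bij C D E ->
    (forall z, corresponds C E z (M z)) -> continuous M.
  move=> stW rD cC ECD MP z U /(clopen_basis stW)[V [cV Vz VU]].
  have [k [Dk _ kz kV]] := rD _ _ cV Vz.
  have [h Ch hk] := iso_surj ECD Dk.
  suff : nbhs z (supp h).
    apply: filterS => w /(MP w h Ch); rewrite hk => /kV; exact: VU.
  by apply: (clopen_nbhs (cC _ Ch)); apply/(MP z h Ch); rewrite hk.
exists (Homeo LK L'K (cont _ _ _ _ _ _ stY rB cA FAB LP)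
                     (cont _ _ _ _ _ _ stX rA cB F'BA L'P)).
move=> g Ag x /=.
apply: (corresponds_uniq stY rB FAB) (LP (g x)).
exact: corresponds_image.
Qed.

(** * Topological full groups *)

Section IntegerPowers.
Variable G : groupType.
Implicit Types (g h : G) (m n : int).

Lemma expgz_succ g n : expgz g (n + 1)%R = g * expgz g n.
Proof.
case: n => [n|[|n]]; first by rewrite -PoszD addn1 /= expgS.
  by rewrite /= expg1 mulgV.
rewrite (_ : (Negz n.+1 + 1)%R = Negz n); last by lia.
by rewrite /= [g ^+ n.+2]expgSr invgM mulVKg.
Qed.

Lemma expgzD g m n : expgz g (m + n)%R = expgz g m * expgz g n.
Proof.
have pos k : expgz g (k%:Z + n)%R = g ^+ k * expgz g n.
  elim: k => [|k IHk]; first by rewrite add0r mul1g.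
  by rewrite intS -addrA addrC expgz_succ IHk expgS mulgA.
case: m => [m|m]; first exact: pos.
apply: (mulgI (g ^+ m.+1)); rewrite /= mulVKg.
have neg k l : expgz g (l - k%:Z)%R = g ^- k * expgz g l.
  elim: k l => [|k IHk] l; first by rewrite subr0 expg0 invg1 mul1g.
  rewrite intS opprD addrA IHk expgS invgM -mulgA; congr (_ * _).
  by apply: (mulgI g); rewrite -expgz_succ subrK mulVKg.
by rewrite addrC NegzE neg mulVKg.
Qed.

Lemma expgzN g n : expgz g (- n)%R = (expgz g n)^-1.
Proof.
by apply: (mulgI (expgz g n)); rewrite -expgzD subrr mulgV.
Qed.

Lemma expgzVn g n : expgz g^-1 n = expgz g (- n)%R.
Proof.
by rewrite expgzN; case: n => n /=; rewrite expVgn.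
Qed.

Lemma expgz_sub A g n : subgroup A -> A g -> A (expgz g n).
Proof.
move=> [A1 AM AV] Ag.
have AX k : A (g ^+ k) by elim: k => // k IHk; rewrite expgS; exact: AM.
by case: n => n /=; [|apply: AV]; exact: AX.
Qed.

End IntegerPowers.

Section Orbits.
Variable X : topologicalType.
Variable phi : homeo_group X.

Lemma expgzDE m n x : expgz phi (m + n)%R x = expgz phi m (expgz phi n x).
Proof. by rewrite expgzD homeo_mulE. Qed.

Lemma expgzKE n x : expgz phi (- n)%R (expgz phi n x) = x.
Proof. by rewrite -expgzDE addNr. Qed.

Lemma expgzVKE n x : expgz phi n (expgz phi (- n)%R x) = x.
Proof. by rewrite -expgzDE subrr. Qed.

End Orbits.

Definition locally_constant (X : topologicalType) (T : Type) (u : X -> T) :=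
  forall x, \forall y \near x, u y = u x.

Lemma locally_homeo_continuous (X Y : topologicalType) (F : X -> Y) :
  (forall x : X, exists h : homeo X Y, \forall y \near x, F y = h y) ->
  continuous F.
Proof.
move=> lF x; have [h hx] := lF x => U.
rewrite (nbhs_singleton hx) => /(@homeo_continuous _ _ h x).
rewrite !nbhs_simpl /=; apply: filterS2 hx => y E.
by rewrite /preimage /= E.
Qed.

Section LocallyConstant.
Variable X : topologicalType.

Lemma locally_constant_clopen (T : Type) (u : X -> T) (S : set T) :
  locally_constant u -> clopen (u @^-1` S).
Proof.
move=> lu; have op S' : open (u @^-1` S').
  rewrite openE => x Sx; rewrite /interior /=.
  by apply: filterS (lu x) => y /= ->.
split; first exact: op.
by rewrite -[X in closed X]setCK; apply: open_closedC; exact: op (~` S).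
Qed.

Lemma locally_constant_bounded (u : X -> int) : compact [set: X] ->
  locally_constant u -> exists M : nat, forall x, (`|u x| <= M)%N.
Proof.
move=> cX lu.
have := (compact_near_coveringP [set: X]).1 cX nat \oo%classic
  (fun n x => (`|u x| <= n)%N) _.
move=> /(_ _)[|M _ MP]; last by exists M => x; exact: (MP M (leqnn M)).
move=> x _; exists ([set y | u y = u x], [set n | (`|u x| <= n)%N]).
  by split => /=; [exact: lu|exists `|u x|%N].
by move=> [y n] [/= -> ].
Qed.

Lemma locally_constant_comp (T : Type) (u : X -> T) (f : homeo_group X) :
  locally_constant u -> locally_constant (u \o f).
Proof. by move=> lu x; have := @homeo_continuous _ _ f x _ (lu (f x)). Qed.

Lemma locally_constant_sum (I : Type) (r : seq I) (u : I -> X -> int) :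
  (forall i, locally_constant (u i)) ->
  locally_constant (fun x => \sum_(i <- r) u i x)%R.
Proof.
move=> lu; elim: r => [|i r IHr] x.
  by apply: filterE => y; rewrite !big_nil.
apply: filterS2 (lu i x) (IHr x) => y ui ur.
by rewrite !big_cons ui ur.
Qed.

End LocallyConstant.

Section MinimalSystems.
Variables (K : numDomainType) (X : pmetricType K) (phi : homeo_group X).
Hypothesis mphi : cantor_minimal phi.
Implicit Types f g h : homeo_group X.

Lemma minimal_stone : stone_space X.
Proof. by case: mphi => [[]]. Qed.

Lemma minimal_compact : compact [set: X].
Proof. by case: minimal_stone. Qed.

Lemma expgz_inj x : injective (fun n => expgz phi n x).
Proof. exact: cantor_minimal_inj. Qed.

Lemma expgz_fixed n x : expgz phi n x = x -> n = 0%R.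
Proof. by move=> E; apply: (@expgz_inj x); rewrite /= E. Qed.

Lemma minimal_visit (U : set X) (x : X) : open U -> U !=set0 ->
  exists n, U (expgz phi n x).
Proof.
move=> oU U0; have [_ dphi] := mphi; have [y [Uy [n _ yE]]] := dphi x U U0 oU.
by exists n; rewrite yE.
Qed.

(** A nonempty level set is open, hence met by every orbit. *)
Lemma invariant_constant (T : Type) (u : X -> T) : locally_constant u ->
  (forall x, u (phi x) = u x) -> forall x y, u x = u y.
Proof.
move=> lu inv x y.
have invz n z : u (expgz phi n z) = u z.
  have invn k w : u ((phi ^+ k) w) = u w.
    by elim: k => // k IHk; rewrite expgS homeo_mulE inv.
  case: n => n /=; first exact: invn.
  by rewrite -[in RHS](homeo_mulVKE (phi ^+ n.+1) z) invn.
have [oU _] : clopen (u @^-1` [set u x]) by exact: locally_constant_clopen.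
have [|n] := minimal_visit y oU; first by exists x.
by rewrite /= invz.
Qed.

Lemma nbhs_avoid (U F : set X) (x : X) : nbhs x U -> finite_set F ->
  exists2 y, U y & ~ F y.
Proof.
move=> nU fF; have [[/perfectTP pX _ hX _] _] := mphi.
apply: contrapT => nex; apply: (pX x).
have acc : accessible_space X by exact: hausdorff_accessible.
suff -> : [set x] = U^° `&` ~` (F `\` [set x]).
  apply: openI; first exact: open_interior.
  apply: closed_openC; apply: (accessible_finite_set_closed.1 acc).
  exact: finite_setD.
apply/seteqP; split=> [_ ->|y [/interior_subset Uy Fy]].
  by split => // -[_]; exact.
apply: contrapT => yx; apply: nex; exists y => // Fy'.
by apply: Fy.
Qed.

(** Deleting a finite piece of orbit from a nonempty open set leaves a nonempty
    open set, because there are no isolated points; the orbit visits it again. *)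
Lemma minimal_returns (U : set X) (x : X) k : open U -> U x ->
  exists m : nat -> int, [/\ m 0 = 0%R,
    forall i j, (i < k)%N -> (j < k)%N -> m i = m j -> i = j &
    forall i, U (expgz phi (m i) x)].
Proof.
move=> oU Ux; elim: k => [|k [m [m0 mi mU]]]; first by exists (fun=> 0%R).
case: k mi => [|k] mi.
  by exists m; split => // -[|i] // [|j].
pose F := [set expgz phi (m i) x | i in `I_k.+1].
have fF : finite_set F by apply: finite_image; exact: finite_II.
have acc : accessible_space X.
  by have [_ hX _] := minimal_stone; exact: hausdorff_accessible.
have [|y Uy Fy] := @nbhs_avoid U F x _ fF; first exact: open_nbhs_nbhs.
have [||n [Un Fn]] := @minimal_visit (U `&` ~` F) x.
- apply: openI => //; apply: closed_openC.
  exact: (accessible_finite_set_closed.1 acc).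
- by exists y.
have mn i : (i < k.+1)%N -> m i <> n.
  by move=> ik E; apply: Fn; exists i => //=; rewrite E.
exists (fun i => if (i == k.+1)%N then n else m i); split => //=.
- move=> i j ik jk; case: (eqVneq i k.+1) => [ik1|ik1];
    case: (eqVneq j k.+1) => [jk1|jk1] E.
  + by rewrite ik1 jk1.
  + by case: (mn j) => //; lia.
  + by case: (mn i) => //; lia.
  + by apply: mi E; lia.
- by move=> i; case: ifP.
Qed.

(** Aperiodicity makes the exponent unique, so local equality with a power of
    phi is the same as local constancy of the cocycle. In this form membership
    is visibly local and stable under products, inverses and conjugation. *)
Lemma tfgP f : topological_full_group phi f <->
  forall x : X, exists n, \forall y \near x, f y = expgz phi n y.
Proof.
split=> [[ff cf] x|lf].
  exists (cocycle phi f x).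
  have nx : \forall y \near x, cocycle phi f y = cocycle phi f x.
    exact: (cf x [set cocycle phi f x] (discrete_set1 _)).
  by apply: filterS nx => y <-; exact: cocycleP.
split=> [x|x U Ux].
  by have [n /nbhs_singleton ->] := lf x; exists n.
have [n nx] := lf x.
have cx := cocycle_unique mphi (nbhs_singleton nx).
rewrite nbhs_simpl; apply: filterS nx => y /(cocycle_unique mphi) ny.
by rewrite /preimage /= ny -cx; exact: nbhs_singleton.
Qed.

Lemma cocycleE f x : topological_full_group phi f ->
  f x = expgz phi (cocycle phi f x) x.
Proof. by case=> ff _; exact: cocycleP. Qed.

Lemma cocycle_locally_constant f : topological_full_group phi f ->
  locally_constant (cocycle phi f).
Proof.
move=> /tfgP lf x; have [n nx] := lf x.
have cx := cocycle_unique mphi (nbhs_singleton nx).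
by apply: filterS nx => y /(cocycle_unique mphi) ->.
Qed.

Lemma cocycleM f g x : topological_full_group phi f ->
  topological_full_group phi g ->
  cocycle phi (f * g) x = (cocycle phi f (g x) + cocycle phi g x)%R.
Proof.
move=> tf tg; apply: cocycle_unique => //.
by rewrite expgzDE -cocycleE // -cocycleE.
Qed.

Lemma tfg_subgroup : subgroup (topological_full_group phi).
Proof.
split.
- by apply/tfgP => x; exists 0%R; exact: filterE.
- move=> f g /tfgP lf /tfgP lg; apply/tfgP => x.
  have [n nx] := lg x; have [m mx] := lf (g x).
  exists (m + n)%R.
  have fx : \forall y \near x, f (g y) = expgz phi m (g y).
    exact: (@homeo_continuous _ _ g x _ mx).
  apply: filterS2 nx fx => y gy fy.
  by rewrite homeo_mulE expgzDE -gy.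
- move=> f /tfgP lf; apply/tfgP => x; have [n nx] := lf (f^-1 x).
  exists (- n)%R.
  have fx : \forall y \near x, f (f^-1 y) = expgz phi n (f^-1 y).
    exact: (@homeo_continuous _ _ f^-1 x _ nx).
  apply: filterS fx => y fy.
  by rewrite -[in RHS](homeo_mulVKE f y) fy expgzKE.
Qed.

Lemma tfg_local f : (forall x : X, exists2 g, topological_full_group phi g &
    \forall y \near x, f y = g y) -> topological_full_group phi f.
Proof.
move=> lf; apply/tfgP => x; have [g /tfgP/(_ x)[n nx] fg] := lf x.
by exists n; apply: filterS2 fg nx => y ->.
Qed.

Lemma tfg_clopen_supp f : topological_full_group phi f -> clopen (supp f).
Proof.
move=> tf; rewrite (_ : supp f = cocycle phi f @^-1` [set n | n <> 0%R]).
  exact: locally_constant_clopen (cocycle_locally_constant tf).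
apply/seteqP; split=> x /=; rewrite suppE (cocycleE x tf) => H E; apply: H.
  by rewrite E.
exact: expgz_fixed E.
Qed.

End MinimalSystems.

(** * Permuting five translates of a clopen set *)

Section Towers.
Variables (K : numDomainType) (X : pmetricType K) (phi : homeo_group X).
Hypothesis mphi : cantor_minimal phi.
Variables (V : set X) (m : 'Z_5 -> int).
Hypothesis clopenV : clopen V.
Hypothesis towerV : forall i j v w, V v -> V w ->
  expgz phi (m i) v = expgz phi (m j) w -> i = j.
Implicit Types s t : 'Z_5 -> 'Z_5.

Let level i : set X := expgz phi (- m i)%R @^-1` V.

Let level_uniq i j y : level i y -> level j y -> i = j.
Proof. by move=> iy jy; apply: (towerV iy jy); rewrite !expgzVKE. Qed.

Let levelE i v : V v -> level i (expgz phi (m i) v).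
Proof. by rewrite /level /= expgzKE. Qed.

(** The levels are the five translates of V by the powers m i of phi; the index
    permutation s moves level i to level s i along phi-orbits, and points
    outside the levels stay fixed. *)
Definition tower_map s (y : X) : X :=
  if [pick i | `[< level i y >]] is Some i
  then expgz phi (m (s i)) (expgz phi (- m i)%R y) else y.

Lemma tower_map_level s i v :
  V v -> tower_map s (expgz phi (m i) v) = expgz phi (m (s i)) v.
Proof.
move=> Vv; rewrite /tower_map; case: pickP => [j /asboolP jv|/(_ i)].
  by rewrite -(level_uniq (levelE i Vv) jv) expgzKE.
by move/negbT/asboolPn/(_ (levelE i Vv)).
Qed.

Lemma tower_map_out s y :
  (forall i v, V v -> y <> expgz phi (m i) v) -> tower_map s y = y.
Proof.
move=> ny; rewrite /tower_map; case: pickP => // i /asboolP iy.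
by case: (ny i (expgz phi (- m i)%R y) iy); rewrite expgzVKE.
Qed.

Lemma tower_cases y : (exists i v, V v /\ y = expgz phi (m i) v) \/
  (forall i v, V v -> y <> expgz phi (m i) v).
Proof.
have [yes|no] := pselect (exists i v, V v /\ y = expgz phi (m i) v); first by left.
by right=> i v Vv yE; apply: no; exists i, v.
Qed.

Lemma tower_map_comp s t y : tower_map s (tower_map t y) = tower_map (s \o t) y.
Proof.
have [[i [v [Vv ->]]]|ny] := tower_cases y; first by rewrite !tower_map_level.
by rewrite !tower_map_out.
Qed.

Lemma tower_map_id s y : s =1 id -> tower_map s y = y.
Proof.
move=> s1; have [[i [v [Vv ->]]]|ny] := tower_cases y.
  by rewrite tower_map_level // s1.
by rewrite tower_map_out.
Qed.

Lemma tower_map_locally s (x : X) :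
  exists n, \forall y \near x, tower_map s y = expgz phi n y.
Proof.
have cl i : clopen (level i) by exact: clopen_homeo_preimage.
have [[i [v [Vv xE]]]|nx] := tower_cases x.
  exists (m (s i) - m i)%R.
  have := clopen_nbhs (cl i) (levelE i Vv); rewrite -xE.
  apply: filterS => y Vy.
  by rewrite -[in LHS](expgzVKE phi (m i) y) tower_map_level // expgzDE.
exists 0%R.
have : \forall y \near x, forall i, ~ level i y.
  apply: filter_forall => i; apply: (clopen_nbhs (clopenC setT (cl i))) => ix.
  by apply: (nx i (expgz phi (- m i)%R x) ix); rewrite expgzVKE.
apply: filterS => y ny /=; apply: tower_map_out => i v Vv yE.
by apply: (ny i); rewrite yE; exact: levelE.
Qed.

Lemma tower_map_continuous s : continuous (tower_map s).
Proof.
apply: locally_homeo_continuous => x; have [n nx] := tower_map_locally s x.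
by exists (expgz phi n).
Qed.

Section TowerHomeo.
Variables (s s' : 'Z_5 -> 'Z_5).
Hypotheses (sK : cancel s s') (s'K : cancel s' s).

Definition tower_homeo : homeo_group X.
Proof.
refine (@Homeo X X (tower_map s) (tower_map s') _ _
  (@tower_map_continuous s) (@tower_map_continuous s')).
- by move=> y; rewrite tower_map_comp tower_map_id.
- by move=> y; rewrite tower_map_comp tower_map_id.
Defined.

Lemma tower_homeo_tfg : topological_full_group phi tower_homeo.
Proof. by apply/(tfgP mphi) => x; exact: tower_map_locally. Qed.

End TowerHomeo.

Let cK : cancel (fun i : 'Z_5 => i + 1)%R (fun i => i - 1)%R.
Proof. by move=> i; rewrite addrK. Qed.
Let cVK : cancel (fun i : 'Z_5 => i - 1)%R (fun i => i + 1)%R.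
Proof. by move=> i; rewrite subrK. Qed.
Let tK : cancel (fun i : 'Z_5 => i *+ 2)%R (fun i => i *+ 3)%R.
Proof. by move=> i; apply/val_inj; case: i => [[|[|[|[|[|]]]]]]. Qed.
Let tVK : cancel (fun i : 'Z_5 => i *+ 3)%R (fun i => i *+ 2)%R.
Proof. by move=> i; apply/val_inj; case: i => [[|[|[|[|[|]]]]]]. Qed.

(** A cyclic permutation c of five levels is the commutator of doubling (on the
    indices modulo 5) and c itself, because doubling conjugates c to its
    square. *)
Lemma tower_five_cycle :
  exists g, [/\ commutator_subgroup (topological_full_group phi) g, g ^+ 5 = 1,
    forall i v, V v -> g (expgz phi (m i) v) = expgz phi (m (i + 1)%R) v &
    forall y, (forall i v, V v -> y <> expgz phi (m i) v) -> g y = y].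
Proof.
pose c := tower_homeo cK cVK; pose t := tower_homeo tK tVK.
exists c; split.
- move=> C [_ CS]; apply: CS; exists t, c; split; try exact: tower_homeo_tfg.
  apply: homeoP => y; rewrite !homeo_mulE.
  rewrite -[(t^-1) _]/(tower_map _ _) -[(c^-1) _]/(tower_map _ _).
  rewrite -[(c _)]/(tower_map _ _) -[(t _)]/(tower_map _ _).
  rewrite -[(c _)]/(tower_map _ _) !tower_map_comp /=.
  congr (tower_map _ y); apply/funext => i /=.
  by apply/val_inj; case: i => [[|[|[|[|[|]]]]]].
- apply: homeo_eq1 => y; rewrite !expgS expg0 mulg1 !homeo_mulE.
  do 5![rewrite -[c _]/(tower_map _ _)].
  rewrite !tower_map_comp tower_map_id // => i.
  by apply/val_inj; case: i => [[|[|[|[|[|]]]]]].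
- exact: tower_map_level.
- exact: tower_map_out.
Qed.

End Towers.

Lemma subgroupP (G : groupType) (A : set G) :
  subgroup A <-> group_closed (mem A).
Proof.
split=> [[A1 AM AV]|[A1 AD]].
  by split=> [|f g /set_mem Af /set_mem Ag]; rewrite inE //; apply/AM/AV.
have {}A1 : A 1 by move: A1; rewrite inE.
have {}AD f g : A f -> A g -> A (f / g).
  by move=> Af Ag; have := AD f g; rewrite !inE; exact.
have AV f : A f -> A f^-1 by move=> Af; rewrite -[f^-1]mul1g; exact: AD.
by split=> // f g Af Ag; rewrite -[g]invgK; apply/AD/AV.
Qed.

Section CommutatorSubgroup.
Variables (G : groupType) (A : set G).
Implicit Types B : set G.

Lemma commutator_subgroup_in f g : A f -> A g ->
  commutator_subgroup A (f * g * f^-1 * g^-1).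
Proof. by move=> Af Ag C [_ CS]; apply: CS; exists f, g. Qed.

Lemma commutator_subgroup_sub B : subgroup B ->
  (forall f g, A f -> A g -> B (f * g * f^-1 * g^-1)) ->
  commutator_subgroup A `<=` B.
Proof.
move=> /subgroupP sB AB f; apply; split => // h [a [b [Aa Ab ->]]].
exact: AB.
Qed.

Lemma commutator_subgroup_subgroup : subgroup (commutator_subgroup A).
Proof.
split=> [C [/subgroupP[C1 _ _]] //|f g Df Dg C CP|f Df C CP];
  have [/subgroupP[_ CM CV] _] := CP.
- by apply: CM; [exact: Df|exact: Dg].
- by apply: CV; exact: Df.
Qed.

End CommutatorSubgroup.

Lemma commutator_tfg_sub (K : numDomainType) (X : pmetricType K)
    (phi : homeo_group X) : cantor_minimal phi ->
  commutator_subgroup (topological_full_group phi)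
    `<=` topological_full_group phi.
Proof.
move=> mphi; have stf := tfg_subgroup mphi; have [_ TM TV] := stf.
apply: commutator_subgroup_sub => // f g Tf Tg.
by do ![apply: (TM)|apply: (TV)|done].
Qed.

Section RichnessOfCommutators.
Variables (K : numDomainType) (X : pmetricType K) (phi : homeo_group X).
Hypothesis mphi : cantor_minimal phi.

Let D := commutator_subgroup (topological_full_group phi).

(** With m listing return times of x to U this provides small elements of order
    five, and with m i = i elements that coincide with phi near x. *)
Lemma five_cycle_at (U : set X) (x : X) (m : 'Z_5 -> int) :
    injective m -> m 0%R = 0%R -> clopen U ->
    (forall i, U (expgz phi (m i) x)) ->
  exists g, [/\ D g, g ^+ 5 = 1, supp g `<=` U &
                \forall y \near x, g y = expgz phi (m 1%R) y].
Proof.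
move=> mi m0 cU Um; have stX := minimal_stone mphi.
have nW : \forall y \near x, forall i, U (expgz phi (m i) y).
  apply: filter_forall => i.
  exact: (@homeo_continuous _ _ (expgz phi (m i)) x _ (clopen_nbhs cU (Um i))).
pose s := [seq expgz phi (m i - m j)%R |
             i <- enum 'Z_5, j <- [seq j <- enum 'Z_5 | j != i]].
have [|V [cV Vx VW Vs]] := @clopen_displaced _ stX s _ x nW.
  move=> h /allpairsPdep[i [j [_]]]; rewrite mem_filter => /andP[ji _] ->.
  move=> /(expgz_fixed mphi)/eqP; rewrite subr_eq0 => /eqP/mi ij.
  by rewrite ij eqxx in ji.
have towerV i j v w : V v -> V w ->
    expgz phi (m i) v = expgz phi (m j) w -> i = j.
  move=> Vv Vw E; apply: contrapT => /eqP ij.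
  apply: (Vs (expgz phi (m i - m j)%R) v _ Vv).
    apply/allpairsPdep; exists i, j; split=> //; first exact: mem_enum.
    by rewrite mem_filter mem_enum andbT eq_sym.
  by rewrite addrC expgzDE E expgzKE.
have [g [Dg g5 gV gN]] := tower_five_cycle mphi cV towerV.
exists g; split => //.
  move=> y gy; apply: contrapT => Uy; apply: gy; apply: gN => i v /VW Uv yE.
  by apply: Uy; rewrite yE; exact: Uv.
apply: filterS (clopen_nbhs cV Vx) => y Vy.
by have := gV 0%R y Vy; rewrite m0 add0r.
Qed.

Lemma commutator_tfg_rich : rich D.
Proof.
move=> U x cU Ux.
have [m [m0 mi mU]] := minimal_returns mphi 5 (clopen_open cU) Ux.
have mi' : injective (fun i : 'Z_5 => m i).
  by move=> i j E; apply/val_inj; apply: mi E; exact: ltn_ord.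
have [g [Dg g5 gU gx]] := @five_cycle_at U x _ mi' m0 cU (fun i => mU i).
exists g; split => //; rewrite suppE (nbhs_singleton gx).
move=> /(expgz_fixed mphi); rewrite -m0 => m1.
by have := mi' 1%R 0%R m1.
Qed.

Lemma commutator_tfg_local (x : X) :
  exists2 g, D g & \forall y \near x, g y = phi y.
Proof.
have mi : injective (fun i : 'Z_5 => Posz i).
  by move=> i j [] E; exact: val_inj.
have [//|//|g [Dg _ _ gx]] := @five_cycle_at setT x _ mi _ clopenT.
by exists g => //; apply: filterS gx => y ->; rewrite /= expg1.
Qed.

End RichnessOfCommutators.

Definition homeo_conj (X Y : topologicalType) (L : homeo X Y)
  (f : homeo_group X) : homeo_group Y := homeo_comp (homeo_comp L f) (homeo_sym L).

Section Conjugation.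
Variables (X Y : topologicalType) (L : homeo X Y).
Implicit Types f g : homeo_group X.

Lemma homeo_conjE f y : homeo_conj L f y = L (f (homeo_sym L y)).
Proof. by []. Qed.

Lemma homeo_conj_app f x : homeo_conj L f (L x) = L (f x).
Proof. by rewrite homeo_conjE /= homeoK. Qed.

Lemma homeo_conjM f g : homeo_conj L (f * g) = homeo_conj L f * homeo_conj L g.
Proof. by apply: homeoP => y; rewrite homeo_mulE !homeo_conjE /= homeoK. Qed.

Lemma homeo_conj1 : homeo_conj L 1 = 1.
Proof. by apply: homeoP => y; exact: homeoVK. Qed.

Lemma homeo_conjV f : homeo_conj L f^-1 = (homeo_conj L f)^-1.
Proof.
by apply: (mulgI (homeo_conj L f)); rewrite -homeo_conjM !mulgV homeo_conj1.
Qed.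

Lemma homeo_conjz f n : homeo_conj L (expgz f n) = expgz (homeo_conj L f) n.
Proof.
have conjX k : homeo_conj L (f ^+ k) = homeo_conj L f ^+ k.
  elim: k => [|k IHk]; first exact: homeo_conj1.
  by rewrite !expgS homeo_conjM IHk.
by case: n => n /=; rewrite ?homeo_conjV conjX.
Qed.

Lemma homeo_conjK : cancel (homeo_conj L) (homeo_conj (homeo_sym L)).
Proof. by move=> f; apply: homeoP => x; rewrite /= !homeoK. Qed.

Lemma homeo_conjVK : cancel (homeo_conj (homeo_sym L)) (homeo_conj L).
Proof. by move=> f; apply: homeoP => x; rewrite /= !homeoVK. Qed.

End Conjugation.

Lemma homeo_conj_minimal (K1 K2 : numDomainType) (X : pmetricType K1)
    (Y : pmetricType K2) (L : homeo X Y) (phi : homeo_group X) :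
  cantor_like Y -> cantor_minimal phi -> cantor_minimal (homeo_conj L phi).
Proof.
move=> cY mphi; split => // y U [z Uz] oU.
have oLU : open (L @^-1` U) by apply: open_comp => // x _; exact: homeo_continuous.
have [|n Un] := minimal_visit mphi (homeo_sym L y) oLU.
  by exists (homeo_sym L z); rewrite /preimage /= homeoVK.
exists (L (expgz phi n (homeo_sym L y))); split => //.
by exists n => //=; rewrite -homeo_conjz.
Qed.

(** The isomorphism is conjugation by a homeomorphism L. Near every point each
    generator coincides with a commutator of its topological full group, which L
    carries into the other topological full group; being local, membership in
    that group passes to the conjugated generator itself. *)
Lemma isomorphism_same_tfg (K1 K2 : numDomainType) (X : pmetricType K1)
    (Y : pmetricType K2) (phi : homeo_group X) (psi : homeo_group Y)
    (A : set (homeo_group X)) (B : set (homeo_group Y)) :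
    cantor_minimal phi -> cantor_minimal psi -> subgroup A -> subgroup B ->
    commutator_subgroup (topological_full_group phi) `<=` A ->
    A `<=` topological_full_group phi ->
    commutator_subgroup (topological_full_group psi) `<=` B ->
    B `<=` topological_full_group psi ->
    subgroup_isomorphic A B ->
  exists L : homeo X Y, topological_full_group psi (homeo_conj L phi) /\
    topological_full_group (homeo_conj L phi) psi.
Proof.
move=> mphi mpsi sA sB DA AT DB BT [F FAB FM].
have richA : rich A.
  move=> U x cU Ux; have [g [Dg g5 gx gU]] := commutator_tfg_rich mphi cU Ux.
  by exists g; split => //; exact: DA.
have richB : rich B.
  move=> U x cU Ux; have [g [Dg g5 gx gU]] := commutator_tfg_rich mpsi cU Ux.
  by exists g; split => //; exact: DB.
have [||L LF] := spatial_isomorphism (minimal_stone mphi) (minimal_stone mpsi)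
  richA richB _ _ sA sB FAB FM.
- by move=> f /AT; exact: tfg_clopen_supp.
- by move=> f /BT; exact: tfg_clopen_supp.
have FL g : A g -> F g = homeo_conj L g.
  move=> Ag; apply: homeoP => y.
  by rewrite -[in LHS](homeoVK L y) (LF g Ag).
exists L; split.
  apply: (tfg_local mpsi) => y.
  have [g Dg gy] := commutator_tfg_local mphi (homeo_sym L y).
  exists (F g); first by apply/BT/(iso_sub FAB)/DA.
  have : \forall z \near y, g (homeo_sym L z) = phi (homeo_sym L z).
    exact: (@homeo_continuous _ _ (homeo_sym L) y _ gy).
  by apply: filterS => z gz; rewrite FL ?homeo_conjE ?gz //; exact: DA.
have cY : cantor_like Y by case: mpsi.
have mLphi := homeo_conj_minimal L cY mphi.
apply: (tfg_local mLphi) => y.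
have [k /DB Bk ky] := commutator_tfg_local mpsi y.
have [g Ag gk] := iso_surj FAB Bk.
exists k; last by apply: filterS ky => z ->.
rewrite -gk FL //; apply/(tfgP mLphi) => z.
have [n nz] := (tfgP mphi g).1 (AT _ Ag) (homeo_sym L z).
exists n; have : \forall w \near z,
    g (homeo_sym L w) = expgz phi n (homeo_sym L w).
  exact: (@homeo_continuous _ _ (homeo_sym L) z _ nz).
by apply: filterS => w gw; rewrite -homeo_conjz !homeo_conjE gw.
Qed.

(** * Relative index of commensurate sets *)

Section RelativeIndex.
Variable X : choiceType.
Implicit Types A B C : set X.

Definition mem_int A x : int := `[< A x >].

(** The entries of r are the finitely many exceptions. *)
Definition commensurate A B :=
  exists r : seq X, forall x, x \notin r -> A x <-> B x.

(** For commensurate sets this is the number of points of A outside B minus the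
    number of points of B outside A. Summing over all points makes additivity and
    invariance under bijections immediate; the sum is zero by convention if its
    support is infinite. *)
Definition rel_index A B : int :=
  (\sum_(x \in [set: X]) (mem_int A x - mem_int B x))%R.

Lemma mem_int_eq A B x : (A x <-> B x) -> mem_int A x = mem_int B x.
Proof. by move=> AB; rewrite /mem_int (asbool_equiv_eq AB). Qed.

Lemma rel_indexE r A B : uniq r -> (forall x, x \notin r -> A x <-> B x) ->
  rel_index A B = (\sum_(x <- r) (mem_int A x - mem_int B x))%R.
Proof.
move=> ur AB; rewrite /rel_index (fsbigE r) //.
  by apply: eq_bigl => x; rewrite in_setT.
by move=> x _ /AB /mem_int_eq ->; rewrite subrr.
Qed.

Lemma commensurate_sym A B : commensurate A B -> commensurate B A.
Proof. by move=> [r AB]; exists r => x /AB AxB; split=> /AxB. Qed.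

Lemma commensurate_trans B A C :
  commensurate A B -> commensurate B C -> commensurate A C.
Proof.
move=> [r AB] [s BC]; exists (r ++ s) => x; rewrite mem_cat negb_or.
by move=> /andP[/AB AxB /BC BxC]; split=> [/AxB/BxC|/BxC/AxB].
Qed.

Lemma rel_index_trans B A C : commensurate A B -> commensurate B C ->
  (rel_index A B + rel_index B C)%R = rel_index A C.
Proof.
move=> [r AB] [s BC]; pose q := undup (r ++ s).
have inq x : x \notin q -> x \notin r /\ x \notin s.
  by rewrite mem_undup mem_cat negb_or => /andP[].
rewrite !(@rel_indexE q) ?undup_uniq //; try by move=> x /inq[/AB ABx /BC BCx].
  by rewrite -big_split; apply: eq_bigr => x _ /=; rewrite addrA subrK.
by move=> x /inq[/AB ABx /BC BCx]; split=> [/ABx/BCx|/BCx/ABx].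
Qed.

Lemma rel_indexxx A : rel_index A A = 0%R.
Proof. by rewrite (@rel_indexE [::]) // big_nil. Qed.

Lemma rel_index_sym A B : commensurate A B -> rel_index B A = (- rel_index A B)%R.
Proof.
move=> cAB; apply/eqP; rewrite -addr_eq0 rel_index_trans ?rel_indexxx //.
exact: commensurate_sym.
Qed.

Lemma rel_indexC A B : commensurate A B ->
  rel_index (~` A) (~` B) = (- rel_index A B)%R.
Proof.
move=> [r AB]; rewrite !(@rel_indexE (undup r)) ?undup_uniq //.
- rewrite -sumrN; apply: eq_bigr => x _.
  by rewrite /mem_int !asbool_neg; case: asboolP; case: asboolP.
- by move=> x; rewrite mem_undup => /AB.
- by move=> x; rewrite mem_undup => /AB ABx; split=> H /ABx.
Qed.

End RelativeIndex.

Lemma rel_index_preimage (X Y : choiceType) (f : X -> Y) (A B : set Y) :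
  bijective f -> rel_index (f @^-1` A) (f @^-1` B) = rel_index A B.
Proof. by move=> bf; rewrite /rel_index (reindex_fsbigT f). Qed.

Lemma commensurate_preimage (X Y : choiceType) (f : X -> Y) (A B : set Y) :
  bijective f -> commensurate A B -> commensurate (f @^-1` A) (f @^-1` B).
Proof.
move=> [g fK gK] [r AB]; exists (map g r) => x xr; apply: AB.
by apply: contra xr => /(map_f g); rewrite fK.
Qed.

Lemma homeo_bij (X Y : topologicalType) (f : homeo X Y) : bijective f.
Proof. by exists (homeo_inv f); [exact: homeoK|exact: homeoVK]. Qed.

Lemma sum_le_iota (c : int) (L : nat) : (0 <= c <= L%:Z)%R ->
  (\sum_(k <- iota 0 L) ((c <= k%:Z)%R : int) = L%:Z - c)%R.
Proof.
elim: L c => [|L IHL] c cL; first by rewrite big_nil; lia.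
rewrite -[in iota 0 _]addn1 iotaD big_cat big_seq1 /= add0n.
have [->|cL'] := eqVneq c (Posz L.+1).
  rewrite big1_seq => [|k]; first by lia.
  by rewrite mem_iota => kL; case: leP => //; lia.
by rewrite IHL; [case: leP; lia|lia].
Qed.

Section HalfOrbits.
Variables (K : numDomainType) (X : pmetricType K).
Implicit Types (phi psi : homeo_group X) (x : X).

Definition half_orbit phi x : set X :=
  [set y | exists2 n : int, (0 <= n)%R & y = expgz phi n x].

Lemma half_orbitP phi psi x n k : cantor_minimal phi ->
  psi x = expgz phi n x ->
  half_orbit phi (psi x) (expgz phi k x) <-> (n <= k)%R.
Proof.
move=> mphi ->; split=> [[l l0]|nk].
  by rewrite -expgzDE => /(expgz_inj mphi) ->; lia.
by exists (k - n)%R; [lia|rewrite -expgzDE subrK].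
Qed.

Lemma half_orbit0P phi x k : cantor_minimal phi ->
  half_orbit phi x (expgz phi k x) <-> (0 <= k)%R.
Proof. by move=> mphi; exact: (@half_orbitP phi 1 x 0%R k mphi). Qed.

(** The points of the orbit of x with time parameter in [-M, M). *)
Definition window phi (M : nat) x : seq X :=
  [seq expgz phi (k%:Z - M%:Z)%R x | k <- iota 0 (M + M)].

Lemma window_uniq phi M x : cantor_minimal phi -> uniq (window phi M x).
Proof.
move=> mphi; rewrite map_inj_uniq ?iota_uniq // => i j.
by move=> /(expgz_inj mphi); lia.
Qed.

Lemma mem_window phi M x (k : int) : (- M%:Z <= k < M%:Z)%R ->
  expgz phi k x \in window phi M x.
Proof.
move=> kM; apply/mapP; exists `|(k + M%:Z)%R|%N; first by rewrite mem_iota; lia.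
by congr (expgz phi _ x); lia.
Qed.

Section Window.
Variables (phi : homeo_group X) (x : X) (B : set X) (M : nat).
Hypothesis mphi : cantor_minimal phi.
Hypothesis B_orbit : B `<=` Defs.orbit phi x.
Hypothesis B_up : forall k : int, (M%:Z <= k)%R -> B (expgz phi k x).
Hypothesis B_down : forall k : int, (k < - M%:Z)%R -> ~ B (expgz phi k x).

Let outside y : y \notin window phi M x -> B y <-> half_orbit phi x y.
Proof.
move=> yw; have [[k _ kx]|ny] := pselect (Defs.orbit phi x y); last first.
  split=> [/B_orbit//|[n _ yE]].
  by case: ny; rewrite yE; exists n.
rewrite -kx in yw *; rewrite half_orbit0P //.
have [kM|kM] := leP M%:Z%R k; first by split=> _; [lia|exact: B_up].
have [kM'|kM'] := ltP k (- M%:Z)%R.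
  by split=> [/(B_down kM')|]; [|lia].
by rewrite mem_window ?kM' in yw.
Qed.

Lemma window_commensurate : commensurate B (half_orbit phi x).
Proof. by exists (window phi M x). Qed.

(** Writing the index as a sum over a window of fixed size shows that it is
    locally constant, and integrable term by term, when B varies with x. *)
Lemma window_index : rel_index B (half_orbit phi x) =
  (\sum_(k <- iota 0 (M + M)) mem_int B (expgz phi (k%:Z - M%:Z) x) - M%:Z)%R.
Proof.
rewrite (rel_indexE (window_uniq M x mphi) outside) big_map sumrB; congr (_ - _)%R.
transitivity (\sum_(k <- iota 0 (M + M)) ((M%:Z <= k%:Z)%R : int))%R; last first.
  by rewrite sum_le_iota; lia.
apply: eq_bigr => k _; congr ((_ : bool) : int); apply/asboolP/idP.
  by move/half_orbit0P => /(_ mphi); lia.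
by move=> kM; apply/half_orbit0P => //; lia.
Qed.

End Window.

(** Only the value of psi at x is prescribed, so that the lemma applies to the
    generator of the system and also to that of another system with the same
    orbits. *)
Lemma half_orbit_shift phi psi x n : cantor_minimal phi ->
    psi x = expgz phi n x ->
  commensurate (half_orbit phi x) (half_orbit phi (psi x)) /\
  rel_index (half_orbit phi x) (half_orbit phi (psi x)) = n.
Proof.
move=> mphi psin.
suff [cB iB] : commensurate (half_orbit phi (psi x)) (half_orbit phi x) /\
    rel_index (half_orbit phi (psi x)) (half_orbit phi x) = (- n)%R.
  split; first exact: commensurate_sym.
  by rewrite rel_index_sym // iB opprK.
have Bo : half_orbit phi (psi x) `<=` Defs.orbit phi x.
  by move=> _ [k _ ->]; exists (k + n)%R => //; rewrite expgzDE -psin.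
have Bu (k : int) : (`|n|%N%:Z <= k)%R ->
    half_orbit phi (psi x) (expgz phi k x).
  by move=> kn; apply/(half_orbitP _ mphi psin); lia.
have Bd (k : int) : (k < - `|n|%N%:Z)%R ->
    ~ half_orbit phi (psi x) (expgz phi k x).
  by move=> kn /(half_orbitP _ mphi psin); lia.
split; first exact: window_commensurate Bo Bu Bd.
rewrite (window_index mphi Bo Bu Bd).
rewrite (eq_bigr (fun k => (`|n|%N%:Z + n <= k%:Z)%R : int)) => [|k _].
  by rewrite sum_le_iota; lia.
congr ((_ : bool) : int); apply/asboolP/idP.
  by move/(half_orbitP _ mphi psin); lia.
by move=> kn; apply/(half_orbitP _ mphi psin); lia.
Qed.

End HalfOrbits.

(** * Equal topological full groups imply flip conjugacy *)

Section Boyle.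
Variables (K : numDomainType) (X : pmetricType K) (phi psi : homeo_group X).
Hypotheses (mphi : cantor_minimal phi) (mpsi : cantor_minimal psi).
Hypothesis phi_psi : topological_full_group psi phi.
Hypothesis psi_phi : topological_full_group phi psi.

Let a (k : int) (x : X) : int := cocycle psi (expgz phi k) x.
Let b (k : int) (x : X) : int := cocycle phi (expgz psi k) x.

Let a_tfg k : topological_full_group psi (expgz phi k).
Proof. exact: expgz_sub (tfg_subgroup mpsi) phi_psi. Qed.

Let b_tfg k : topological_full_group phi (expgz psi k).
Proof. exact: expgz_sub (tfg_subgroup mphi) psi_phi. Qed.

Let aE k x : expgz phi k x = expgz psi (a k x) x.
Proof. exact: cocycleE. Qed.

Let bE k x : expgz psi k x = expgz phi (b k x) x.
Proof. exact: cocycleE. Qed.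

Let a_const k : locally_constant (a k).
Proof. exact: cocycle_locally_constant. Qed.

Let aD k l x : a (k + l)%R x = (a k (expgz phi l x) + a l x)%R.
Proof. by rewrite /a expgzD cocycleM. Qed.

Let a0 x : a 0%R x = 0%R.
Proof. by have := aD 0 0 x; rewrite addr0 /=; lia. Qed.

Let aN k x : a k x = (- a (- k) (expgz phi k x))%R.
Proof. by have := aD (- k)%R k x; rewrite addNr a0; lia. Qed.

Lemma cocycle_expgz_bound (N : nat) (theta eta : homeo_group X) :
    cantor_minimal eta -> topological_full_group eta theta ->
    (forall x, (`|cocycle eta theta x| <= N)%N) ->
  forall k x, (`|cocycle eta (expgz theta k) x| <= N * `|k|)%N.
Proof.
move=> meta et tN.
have Tz k : topological_full_group eta (expgz theta k).
  exact: expgz_sub (tfg_subgroup meta) et.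
have bnd (n : nat) x : (`|cocycle eta (expgz theta n%:Z) x| <= N * n)%N.
  elim: n => [|n IHn].
    by rewrite (cocycle_unique (n := 0%R) meta) //= muln0.
  rewrite intS addrC expgz_succ cocycleM //.
  by have := tN (expgz theta n%:Z x); lia.
move=> [n|n] x; first exact: bnd.
have -> : cocycle eta (expgz theta (Negz n)) x =
    (- cocycle eta (expgz theta n.+1%:Z) (expgz theta (Negz n) x))%R.
  apply/eqP; rewrite -addr_eq0 addrC -cocycleM // -expgzD NegzE subrr.
  by rewrite (cocycle_unique (n := 0%R) meta).
by have := bnd n.+1 (expgz theta (Negz n) x); lia.
Qed.

Section Positive.
Variable M : nat.
Hypothesis a_pos : forall k x, (M%:Z <= k)%R -> (0 < a k x)%R.

Let a_neg (k : int) x : (k < - M%:Z)%R -> (a k x < 0)%R.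
Proof.
move=> kM; rewrite aN; have := @a_pos (- k)%R (expgz phi k x); lia.
Qed.

Let psi_half x k : half_orbit psi x (expgz phi k x) <-> (0 <= a k x)%R.
Proof. by rewrite aE half_orbit0P. Qed.

Let sub_orbit x : half_orbit psi x `<=` Defs.orbit phi x.
Proof. by move=> _ [k _ ->]; exists (b k x); rewrite // -bE. Qed.

Let half_up x (k : int) : (M%:Z <= k)%R -> half_orbit psi x (expgz phi k x).
Proof. by move=> kM; apply/psi_half; have := a_pos x kM; lia. Qed.

Let half_down x (k : int) :
  (k < - M%:Z)%R -> ~ half_orbit psi x (expgz phi k x).
Proof. by move=> kM /psi_half; have := a_neg x kM; lia. Qed.

Let c x := rel_index (half_orbit psi x) (half_orbit phi x).

Let c_const : locally_constant c.
Proof.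
pose u (k : nat) x : int := (0 <= a (k%:Z - M%:Z)%R x)%R.
have -> : c = fun x => (\sum_(k <- iota 0 (M + M)) u k x + (- M%:Z))%R.
  apply/funext => x; rewrite /c.
  rewrite (window_index mphi (@sub_orbit x) (@half_up x) (@half_down x)).
  congr (_ + _)%R; apply: eq_bigr => k _; congr ((_ : bool) : int).
  by apply/asboolP/idP => /psi_half.
have lu : locally_constant (fun x => \sum_(k <- iota 0 (M + M)) u k x)%R.
  apply: locally_constant_sum => k x; apply: filterS (a_const (k%:Z - M%:Z)%R x).
  by move=> y; rewrite /u => ->.
by move=> x; apply: filterS (lu x) => y ->.
Qed.

Let c_phi x : c (phi x) = (1 + c x - a 1 x)%R.
Proof.
have [cp ip] := half_orbit_shift mphi (psi := phi) (n := 1%R) (erefl (phi x)).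
have phi1 : phi x = expgz psi (a 1%R x) x by rewrite -aE /= expg1.
have [cq iq] := half_orbit_shift mpsi phi1.
have cc := window_commensurate mphi (@sub_orbit x) (@half_up x) (@half_down x).
have cq' := commensurate_sym cq.
rewrite /c -(rel_index_trans (B := half_orbit phi x)) //; last first.
  exact: commensurate_trans cc.
rewrite -(rel_index_trans (B := half_orbit psi x)) // ip (rel_index_sym cq) iq.
by lia.
Qed.

Let F x := expgz psi (c x) x.
Let F' x := expgz phi (- c x)%R x.

Let F_phi x : F (phi x) = psi (F x).
Proof.
rewrite /F c_phi.
have -> : phi x = expgz psi (a 1%R x) x by rewrite -aE /= expg1.
rewrite -expgzDE subrK expgzDE /= expg1.
by [].
Qed.

Let F_phiz k x : F (expgz phi k x) = expgz psi k (F x).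
Proof.
have pos n y : F ((phi ^+ n) y) = (psi ^+ n) (F y).
  by elim: n => // n IHn; rewrite !expgS !homeo_mulE F_phi IHn.
case: k => n; first exact: pos.
apply: (@homeo_inj _ (psi ^+ n.+1)); rewrite -pos.
by rewrite (homeo_mulVKE (phi ^+ n.+1)) (homeo_mulVKE (psi ^+ n.+1)).
Qed.

(* F intertwines phi and psi, so going back c y steps along phi undoes the c y
   steps along psi that lead from y to F y. *)
Let F'K : cancel F' F.
Proof. by move=> y; rewrite /F' F_phiz /F expgzKE. Qed.

Let FK : cancel F F'.
Proof.
move=> x; have [k xk] : exists k, F' (F x) = expgz phi k x.
  by exists (- c (F x) + b (c x) x)%R; rewrite expgzDE -bE.
have := F'K (F x); rewrite xk F_phiz => /(expgz_fixed mpsi) ->.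
by [].
Qed.

(** When the two forward orbits of every point agree up to finitely many points,
    the conjugacy F moves each x along its orbit by the index c x of its forward
    psi-orbit relative to its forward phi-orbit. Indeed, in passing from x to
    phi x the forward phi-orbit loses one point, and the forward psi-orbit loses
    as many points as psi has to be iterated to reach phi x. *)
Lemma positive_conjugate : exists L : homeo X X, homeo_conj L phi = psi.
Proof.
have cF : continuous F.
  apply: locally_homeo_continuous => x; exists (expgz psi (c x)).
  by apply: filterS (c_const x) => y; rewrite /F => ->.
have cF' : continuous F'.
  apply: locally_homeo_continuous => x; exists (expgz phi (- c x)%R).
  by apply: filterS (c_const x) => y; rewrite /F' => ->.
exists (Homeo FK F'K cF cF'); apply: homeoP => y.
by rewrite homeo_conjE /= F_phi F'K.
Qed.

End Positive.

(** Both orbit parametrizations move at bounded speed, so along every orbit a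
    tends to infinity in absolute value uniformly and cannot jump over zero
    from some point on; its final sign is invariant and locally constant,
    hence the same on the whole space. *)
Lemma cocycle_sign : exists M : nat,
  (forall k x, (M%:Z <= k)%R -> (0 < a k x)%R) \/
  (forall k x, (M%:Z <= k)%R -> (a k x < 0)%R).
Proof.
have [N aN1] := locally_constant_bounded (minimal_compact mpsi)
  (cocycle_locally_constant mpsi phi_psi).
have [N' bN] := locally_constant_bounded (minimal_compact mphi)
  (cocycle_locally_constant mphi psi_phi).
have a1 x : (`|a 1%R x| <= N)%N by rewrite /a /= expg1.
have ba k x : b (a k x) x = k by apply: cocycle_unique => //; rewrite -aE.
have big k x : (N' * N < `|k|)%N -> (N < `|a k x|)%N.
  move=> kN; rewrite ltnNge; apply/negP => aN'.
  have := cocycle_expgz_bound mphi psi_phi bN (a k x) x.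
  rewrite -/(b (a k x) x) ba; have := leq_mul (leqnn N') aN'; lia.
(* From time M on, a exceeds in absolute value the largest step N it can make. *)
pose M := (N' * N).+1.
have sgn (n : nat) x : (0 < a (Posz (M + n)) x)%R = (0 < a (Posz M) x)%R.
  elim: n => [|n IHn]; first by rewrite addn0.
  rewrite -IHn addnS intS aD; have := a1 (expgz phi (Posz (M + n)) x).
  have := big (Posz (M + n)) x; rewrite /M; lia.
have inv x : (0 < a (Posz M) (phi x))%R = (0 < a (Posz M) x)%R.
  rewrite -(sgn 1%N x) addn1 intS addrC aD /= expg1.
  have := big (M%:Z + 1)%R x; rewrite aD /= expg1.
  have := a1 x; rewrite /M; lia.
have lc : locally_constant (fun x => 0 < a (Posz M) x)%R.
  by move=> x; apply: filterS (a_const M x) => y ->.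
have sc := invariant_constant mphi lc inv.
have kM k : (M%:Z <= k)%R -> k = Posz (M + (`|k| - M)) by lia.
exists M; have [s|s] := pselect (exists x, 0 < a (Posz M) x)%R.
  by left=> k x /kM ->; rewrite sgn; have [y sy] := s; rewrite (sc x y).
right=> k x kM'; have := big k x; have : ~~ (0 < a k x)%R.
  by rewrite (kM k kM') sgn; apply/negP => sx; apply: s; exists x.
by rewrite /M in kM'; lia.
Qed.

End Boyle.

Lemma minimal_inv (K : numDomainType) (X : pmetricType K)
    (phi : homeo_group X) : cantor_minimal phi -> cantor_minimal phi^-1.
Proof.
move=> mphi; have [cX _] := mphi; split => // x U U0 oU.
have [n Un] := minimal_visit mphi x oU U0.
by exists (expgz phi n x); split => //; exists (- n)%R; rewrite // expgzVn opprK.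
Qed.

Lemma cocycle_inv (K : numDomainType) (X : pmetricType K)
    (phi f : homeo_group X) x : cantor_minimal phi ->
  topological_full_group phi f -> cocycle phi^-1 f x = (- cocycle phi f x)%R.
Proof.
move=> mphi Tf; apply: cocycle_unique; first exact: minimal_inv.
by rewrite expgzVn opprK -cocycleE.
Qed.

Lemma tfg_inv (K : numDomainType) (X : pmetricType K) (phi : homeo_group X) :
  cantor_minimal phi ->
  topological_full_group phi^-1 = topological_full_group phi.
Proof.
have sub (psi : homeo_group X) : cantor_minimal psi ->
    topological_full_group psi `<=` topological_full_group psi^-1.
  move=> mpsi f /(tfgP mpsi) lf; apply/(tfgP (minimal_inv mpsi)) => x.
  by have [n nx] := lf x; exists (- n)%R; rewrite expgzVn opprK.
move=> mphi; apply/seteqP; split; last exact: sub.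
by rewrite -[in X in _ `<=` X](invgK phi); apply/sub/minimal_inv.
Qed.

(** * The flux of an element of a topological full group *)

Section Flux.
Variables (K : numDomainType) (X : pmetricType K) (phi : homeo_group X).
Hypothesis mphi : cantor_minimal phi.
Implicit Types f g : homeo_group X.

(** Under the identification of the orbit of x with the integers f becomes a
    permutation with bounded displacement, and the flux is the number of points
    it carries from the negative to the nonnegative side minus the number it
    carries back. *)
Definition flux f (x : X) : int :=
  rel_index (f @^-1` half_orbit phi x) (half_orbit phi x).

Section FluxWindow.
Variables (f : homeo_group X) (M : nat).
Hypothesis Tf : topological_full_group phi f.
Hypothesis fM : forall x, (`|cocycle phi f x| <= M)%N.

Lemma preimage_half_orbitP x k :
  (f @^-1` half_orbit phi x) (expgz phi k x) <->
  (0 <= cocycle phi f (expgz phi k x) + k)%R.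
Proof.
by rewrite /preimage /= (cocycleE _ Tf) -expgzDE half_orbit0P.
Qed.

Let sub_orbit x : f @^-1` half_orbit phi x `<=` Defs.orbit phi x.
Proof.
move=> y [k _]; rewrite (cocycleE y Tf) => yE.
exists (- cocycle phi f y + k)%R => //.
by rewrite expgzDE -yE expgzKE.
Qed.

Let half_up x (k : int) : (M%:Z <= k)%R ->
  (f @^-1` half_orbit phi x) (expgz phi k x).
Proof.
by move=> kM; apply/preimage_half_orbitP; have := fM (expgz phi k x); lia.
Qed.

Let half_down x (k : int) : (k < - M%:Z)%R ->
  ~ (f @^-1` half_orbit phi x) (expgz phi k x).
Proof.
by move=> kM /preimage_half_orbitP; have := fM (expgz phi k x); lia.
Qed.

Lemma flux_commensurate_window x :
  commensurate (f @^-1` half_orbit phi x) (half_orbit phi x).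
Proof.
exact: (window_commensurate mphi (@sub_orbit x) (@half_up x) (@half_down x)).
Qed.

Lemma flux_window x : flux f x = (\sum_(k <- iota 0 (M + M))
  ((0 <= cocycle phi f (expgz phi (k%:Z - M%:Z) x) + (k%:Z - M%:Z))%R : int)
    - M%:Z)%R.
Proof.
rewrite /flux.
rewrite (window_index mphi (@sub_orbit x) (@half_up x) (@half_down x)).
congr (_ - _)%R; apply: eq_bigr => k _; congr ((_ : bool) : int).
by apply/asboolP/idP => /preimage_half_orbitP.
Qed.

End FluxWindow.

Lemma cocycle_bounded f : topological_full_group phi f ->
  exists M : nat, forall x, (`|cocycle phi f x| <= M)%N.
Proof.
move=> Tf; apply: (locally_constant_bounded (minimal_compact mphi)).
exact: cocycle_locally_constant.
Qed.

Lemma flux_commensurate f x : topological_full_group phi f ->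
  commensurate (f @^-1` half_orbit phi x) (half_orbit phi x).
Proof.
by move=> Tf; have [M fM] := cocycle_bounded Tf; exact: flux_commensurate_window fM x.
Qed.

(** Replacing x by phi x removes one point from each of the two sets. *)
Lemma flux_phi f x : topological_full_group phi f ->
  flux f (phi x) = flux f x.
Proof.
move=> Tf; have [cp ip] := half_orbit_shift mphi (n := 1%R) (erefl (phi x)).
have cp' := commensurate_sym cp; have cf := flux_commensurate x Tf.
have bf := homeo_bij f; have cfp := commensurate_preimage bf cp'.
rewrite /flux -(rel_index_trans (B := f @^-1` half_orbit phi x)) //; last first.
  exact: commensurate_trans cp.
rewrite -(rel_index_trans (B := half_orbit phi x) cf cp) ip.
by rewrite rel_index_preimage // (rel_index_sym cp) ip -/(flux f x); lia.
Qed.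

Lemma flux_constant f x y : topological_full_group phi f -> flux f x = flux f y.
Proof.
move=> Tf; apply: (invariant_constant mphi); last by move=> z; exact: flux_phi.
have [M fM] := cocycle_bounded Tf.
pose u (k : nat) z : int :=
  (0 <= cocycle phi f (expgz phi (k%:Z - M%:Z) z) + (k%:Z - M%:Z))%R.
have lu : locally_constant (fun z => \sum_(k <- iota 0 (M + M)) u k z)%R.
  apply: locally_constant_sum => k z.
  have := locally_constant_comp (expgz phi (k%:Z - M%:Z))
    (cocycle_locally_constant mphi Tf) z.
  by apply: filterS => w; rewrite /u /= => ->.
move=> z; apply: filterS (lu z) => w; rewrite !(flux_window Tf fM) => E.
by congr (_ - _)%R.
Qed.

Lemma fluxM f g x : topological_full_group phi f ->
    topological_full_group phi g ->
  flux (f * g) x = (flux f x + flux g x)%R.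
Proof.
move=> Tf Tg; have bg := homeo_bij g.
have cf := flux_commensurate x Tf; have cg := flux_commensurate x Tg.
have := rel_index_trans (commensurate_preimage bg cf) cg.
by rewrite rel_index_preimage // => ->.
Qed.

Lemma flux1 x : flux 1 x = 0%R.
Proof. exact: rel_indexxx. Qed.

Lemma fluxV f x : topological_full_group phi f ->
  flux f^-1 x = (- flux f x)%R.
Proof.
move=> Tf; have [_ _ TV] := tfg_subgroup mphi.
apply/eqP; rewrite -addr_eq0 -fluxM // ?mulVg ?flux1 //.
exact: TV.
Qed.

End Flux.

(** Inside the orbit of x, the forward orbit of x under the inverse of phi is the
    complement of the forward phi-orbit of phi x, and complementation changes the
    sign of the index; outside the orbit, which f preserves, all contributions
    vanish. *)
Lemma flux_inv (K : numDomainType) (X : pmetricType K) (phi f : homeo_group X)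
    x : cantor_minimal phi -> topological_full_group phi f ->
  flux phi^-1 f x = (- flux phi f x)%R.
Proof.
move=> mphi Tf; rewrite -(flux_phi mphi x Tf) /flux.
rewrite -rel_indexC; last exact: flux_commensurate.
have halfC y : Defs.orbit phi x y ->
    half_orbit phi^-1 x y <-> (~` half_orbit phi (phi x)) y.
  move=> [k _ <-]; have phix : phi x = expgz phi 1 x by rewrite /= expg1.
  rewrite /setC /mkset (half_orbitP _ mphi phix).
  have -> : expgz phi k x = expgz phi^-1 (- k)%R x by rewrite expgzVn opprK.
  by rewrite half_orbit0P; [split; lia|exact: minimal_inv].
have half_sub y : half_orbit phi^-1 x y -> Defs.orbit phi x y.
  by move=> [k _ ->]; exists (- k)%R; rewrite // expgzVn.
have half_sub' y : half_orbit phi (phi x) y -> Defs.orbit phi x y.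
  by move=> [k _ ->]; exists (k + 1)%R; rewrite // expgzDE /= expg1.
have orbitf y : Defs.orbit phi x (f y) -> Defs.orbit phi x y.
  move=> [k _]; rewrite (cocycleE y Tf) => kE.
  by exists (- cocycle phi f y + k)%R; rewrite // expgzDE kE expgzKE.
have orbitf' y : Defs.orbit phi x y -> Defs.orbit phi x (f y).
  move=> [k _ <-]; rewrite (cocycleE _ Tf) -expgzDE.
  by exists (cocycle phi f (expgz phi k x) + k)%R.
have no (A B : set X) y : ~ A y -> ~ B y -> mem_int A y = mem_int B y.
  by move=> nA nB; apply: mem_int_eq; split.
apply: eq_fsbigr => y _; have [oy|oy] := pselect (Defs.orbit phi x y).
  congr (_ - _)%R; apply: mem_int_eq; last exact: halfC.
  exact: (halfC (f y) (orbitf' _ oy)).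
have ofy : ~ Defs.orbit phi x (f y) by move/orbitf.
rewrite (no _ (half_orbit phi^-1 x)); [|by move/half_sub|by move/half_sub].
rewrite subrr (@mem_int_eq _ _ (~` half_orbit phi (phi x))) ?subrr //.
by split=> _ /half_sub'.
Qed.

Section FluxConjugation.
Variables (K1 K2 : numDomainType) (X : pmetricType K1) (Y : pmetricType K2).
Variables (L : homeo X Y) (phi : homeo_group X).

Lemma half_orbit_conj x :
  L @^-1` half_orbit (homeo_conj L phi) (L x) = half_orbit phi x.
Proof.
apply/seteqP; split=> y [n n0].
  rewrite -homeo_conjz homeo_conj_app => /(can_inj (homeoK L)) ->.
  by exists n.
by move=> ->; exists n; rewrite // -homeo_conjz homeo_conj_app.
Qed.

Lemma flux_conj f x :
  flux (homeo_conj L phi) (homeo_conj L f) (L x) = flux phi f x.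
Proof.
rewrite /flux -(rel_index_preimage _ _ (homeo_bij L)) half_orbit_conj.
congr (rel_index _ _); rewrite -half_orbit_conj.
by apply/seteqP; split=> y; rewrite /preimage /= homeoK.
Qed.

End FluxConjugation.

(** * The flux is the integral of the cocycle *)

Section IndicatorSums.
Context d (T : measurableType d) (R : realType) (mu : probability T R).

Lemma integral_constant (c : R) : (\int[mu]_x c%:E = c%:E)%E.
Proof.
rewrite integral_cst // [X in (_ * X)%E](_ : _ = 1%E) ?mule1 //.
exact: probability_setT.
Qed.

Lemma integral_indic_sum (r : seq nat) (S : nat -> set T) (c : R) :
    (forall k, measurable (S k)) ->
  (\int[mu]_x (\sum_(k <- r) \1_(S k) x + c)%:E =
   \sum_(k <- r) mu (S k) + c%:E)%E.
Proof.
move=> mS.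
have iS k : mu.-integrable setT (EFin \o (\1_(S k) : T -> R)%R).
  exact: integrable_indic.
rewrite (eq_integral (fun x => \sum_(k <- r) (\1_(S k) x)%R%:E + c%:E)%E); last first.
  by move=> x _; rewrite EFinD sumEFin.
rewrite integralD //.
- rewrite integral_sum //; congr (_ + _)%E.
    by apply: eq_bigr => k _; rewrite integral_indic // setIT.
  by rewrite integral_constant.
- by apply: integrable_sum => // k _; exact: iS.
- exact: finite_measure_integrable_cst.
Qed.

End IndicatorSums.

Section FluxIntegral.
Variables (R : realType) (X : pmetricType R) (phi : homeo_group X).
Variable mu : probability (borel X) R.
Hypotheses (mphi : cantor_minimal phi) (imu : invariant_measure phi mu).

Lemma clopen_measurable (S : set X) : clopen S -> measurable (S : set (borel X)).
Proof. by move=> [oS _]; exact: sub_sigma_algebra. Qed.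

Lemma invariant_clopen (S : set X) n : clopen S ->
  mu (expgz phi n @^-1` S) = mu S.
Proof.
move=> cS; have pos (k : nat) (U : set X) : clopen U ->
    mu ((phi ^+ k) @^-1` U) = mu U.
  elim: k U => [//|k IHk] U cU.
  rewrite -[RHS]IHk // -[RHS]imu; last first.
    by apply: clopen_measurable; exact: (clopen_homeo_preimage (phi ^+ k) cU).
  by congr (mu _); apply/seteqP; split=> x; rewrite /preimage /= expgSr.
case: n => n; first exact: pos.
rewrite -(pos n.+1); last exact: clopen_homeo_preimage.
congr (mu _); apply/seteqP; split=> x;
  by rewrite /preimage /= homeoK.
Qed.

(** With n the cocycle bounded by M, the number n x + M counts the shifts k
    below 2 M such that n x + k - M is nonnegative, while the flux plus M counts
    the k for which this holds at the point k - M steps along the orbit of x.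
    By invariance the two counts have the same integral. *)
Lemma integral_cocycle f x0 : topological_full_group phi f ->
  (\int[mu]_x ((cocycle phi f x)%:~R)%:E = ((flux phi f x0)%:~R)%:E)%E.
Proof.
move=> Tf; have [M fM] := cocycle_bounded mphi Tf.
pose S (k : nat) : set X := [set x | (0 <= cocycle phi f x + (k%:Z - M%:Z))%R].
have cS k : clopen (S k).
  exact: (locally_constant_clopen [set n | (0 <= n + (k%:Z - M%:Z))%R]
    (cocycle_locally_constant mphi Tf)).
pose S' (k : nat) : set X := expgz phi (k%:Z - M%:Z)%R @^-1` S k.
have cS' k : clopen (S' k) by exact: clopen_homeo_preimage.
have indE (U : set X) (b : bool) x : (U x <-> b) -> (\1_U x : R)%R = (b : int)%:~R%R.
  move=> Ub; rewrite indicE; congr ((_ : bool)%:R)%R.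
  by apply/idP/idP; rewrite inE => /Ub.
transitivity (\int[mu]_x (\sum_(k <- iota 0 (M + M)) \1_(S k) x - M%:R)%:E)%E.
  apply: eq_integral => x _; congr (_%:E).
  have -> : cocycle phi f x = (\sum_(k <- iota 0 (M + M))
      ((M%:Z - cocycle phi f x <= k%:Z)%R : int) - M%:Z)%R.
    by have := fM x => ?; rewrite sum_le_iota; lia.
  rewrite rmorphB rmorph_sum /=; congr (_ - _)%R.
  apply: eq_bigr => k _; apply/esym/indE; rewrite /S /=; lia.
rewrite integral_indic_sum; last by move=> k; exact: clopen_measurable.
transitivity (\int[mu]_x (\sum_(k <- iota 0 (M + M)) \1_(S' k) x - M%:R)%:E)%E.
  rewrite integral_indic_sum; last by move=> k; exact: clopen_measurable.
  by congr (_ + _)%E; apply: eq_bigr => k _; rewrite invariant_clopen.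
rewrite (eq_integral (fun=> ((flux phi f x0)%:~R)%:E)).
  by rewrite integral_constant.
move=> x _; congr (_%:E); rewrite (flux_constant mphi x0 x Tf).
rewrite (flux_window mphi Tf fM) rmorphB rmorph_sum /=; congr (_ - _)%R.
by apply: eq_bigr => k _; apply: indE.
Qed.

(** The right-hand side does not mention the measure: this is the independence
    of the choice of the invariant measure. *)
Lemma tfg0P f : topological_full_group0 phi mu f <->
  topological_full_group phi f /\ flux phi f point = 0%R.
Proof.
split=> [[Tf]|[Tf f0]].
  rewrite (integral_cocycle point Tf) => -[/eqP]; rewrite intr_eq0 => /eqP.
  by split.
by split=> //; rewrite (integral_cocycle point Tf) f0.
Qed.

Lemma tfg0_subgroup : subgroup (topological_full_group0 phi mu).
Proof.
have [T1 TM TV] := tfg_subgroup mphi; split.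
- by apply/tfg0P; rewrite flux1.
- move=> f g /tfg0P[Tf f0] /tfg0P[Tg g0]; apply/tfg0P.
  by split; [exact: TM|rewrite fluxM // f0 g0].
- move=> f /tfg0P[Tf f0]; apply/tfg0P.
  by split; [exact: TV|rewrite fluxV // f0].
Qed.

Lemma commutator_tfg_sub0 :
  commutator_subgroup (topological_full_group phi)
    `<=` topological_full_group0 phi mu.
Proof.
have [_ TM TV] := tfg_subgroup mphi.
apply: commutator_subgroup_sub; first exact: tfg0_subgroup.
move=> f g Tf Tg; have TVf := TV _ Tf; have TVg := TV _ Tg.
have Tfg := TM _ _ Tf Tg; have Tfgf := TM _ _ Tfg TVf.
apply/tfg0P; split; first exact: TM.
by rewrite !fluxM // !fluxV //; lia.
Qed.

End FluxIntegral.

(** * From isomorphisms to flip conjugacies and back *)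

(** After the conjugation by L the two systems have the same topological full
    group; the sign of their mutual cocycle tells whether psi or its inverse is
    the conjugate system. *)
Lemma flip_conjugate_of_isomorphism (K : numDomainType) (X Y : pmetricType K)
    (phi : homeo_group X) (psi : homeo_group Y)
    (A : set (homeo_group X)) (B : set (homeo_group Y)) :
    cantor_minimal phi -> cantor_minimal psi -> subgroup A -> subgroup B ->
    commutator_subgroup (topological_full_group phi) `<=` A ->
    A `<=` topological_full_group phi ->
    commutator_subgroup (topological_full_group psi) `<=` B ->
    B `<=` topological_full_group psi ->
  subgroup_isomorphic A B -> flip_conjugate phi psi.
Proof.
move=> mphi mpsi sA sB DA AT DB BT iAB.
have [L [Tpsi Tphi]] := isomorphism_same_tfg mphi mpsi sA sB DA AT DB BT iAB.
have cY : cantor_like Y by case: mpsi.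
have mphi' := homeo_conj_minimal L cY mphi.
have mpsiV := minimal_inv mpsi.
suff [F FE] : exists F : homeo Y Y,
    homeo_conj F (homeo_conj L phi) = psi \/
    homeo_conj F (homeo_conj L phi) = psi^-1.
  exists (homeo_comp F L) => /=.
  rewrite (_ : homeo_comp _ _ = homeo_conj F (homeo_conj L phi)) //.
  exact: homeoP.
have [M [pos|neg]] := cocycle_sign mphi' mpsi Tpsi Tphi.
  have [F FE] := positive_conjugate mphi' mpsi Tpsi Tphi pos.
  by exists F; left.
have TpsiV : topological_full_group psi^-1 (homeo_conj L phi).
  by rewrite tfg_inv.
have [_ _ TV] := tfg_subgroup mphi'.
have [|F FE] := positive_conjugate mphi' mpsiV TpsiV (TV _ Tphi) (M := M).
  move=> k x kM; rewrite cocycle_inv //; first by have := neg k x kM; lia.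
  exact: expgz_sub (tfg_subgroup mpsi) Tpsi.
by exists F; right.
Qed.

Lemma subgroup_isomorphic_conj (X Y : topologicalType) (L : homeo X Y)
    (A : set (homeo_group X)) (B : set (homeo_group Y)) :
    (forall f, A f -> B (homeo_conj L f)) ->
    (forall k, B k -> A (homeo_conj (homeo_sym L) k)) ->
  subgroup_isomorphic A B.
Proof.
move=> AB BA; exists (homeo_conj L); last first.
  by move=> f g _ _; exact: homeo_conjM.
split=> [f|f g _ _|k Bk]; first exact: AB.
  exact: (can_inj (homeo_conjK L)).
by exists (homeo_conj (homeo_sym L) k); [exact: BA|exact: homeo_conjVK].
Qed.

Lemma commutator_subgroup_conj (X Y : topologicalType) (L : homeo X Y)
    (A : set (homeo_group X)) (B : set (homeo_group Y)) :
    (forall f, A f -> B (homeo_conj L f)) ->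
  forall f, commutator_subgroup A f -> commutator_subgroup B (homeo_conj L f).
Proof.
move=> AB f Df.
suff : commutator_subgroup A
    `<=` [set g | commutator_subgroup B (homeo_conj L g)] by exact.
have [D1 DM DV] := commutator_subgroup_subgroup B.
apply: commutator_subgroup_sub.
  split=> [|g h Dg Dh|g Dg] /=.
  - by rewrite homeo_conj1.
  - by rewrite homeo_conjM; exact: DM.
  - by rewrite homeo_conjV; exact: DV.
move=> g h Ag Ah /=; rewrite !homeo_conjM !homeo_conjV.
by apply: commutator_subgroup_in; exact: AB.
Qed.

Section FlipConjugacy.
Variables (K : numDomainType) (X Y : pmetricType K).
Variables (phi : homeo_group X) (psi : homeo_group Y) (L : homeo X Y).
Hypotheses (mphi : cantor_minimal phi) (mpsi : cantor_minimal psi).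
Hypothesis flipL : homeo_conj L phi = psi \/ homeo_conj L phi = psi^-1.

Let flip_n n : exists m,
  homeo_conj L (expgz phi n) = expgz psi m.
Proof.
rewrite homeo_conjz; case: flipL => ->; first by exists n.
by exists (- n)%R; rewrite expgzVn.
Qed.

Lemma flip_tfg f :
  topological_full_group phi f -> topological_full_group psi (homeo_conj L f).
Proof.
move=> /(tfgP mphi) lf; apply/(tfgP mpsi) => y.
have [n nx] := lf (homeo_sym L y); have [m nm] := flip_n n; exists m.
have ny : \forall z \near y,
    f (homeo_sym L z) = expgz phi n (homeo_sym L z).
  exact: (@homeo_continuous _ _ (homeo_sym L) y _ nx).
by apply: filterS ny => z fz; rewrite -nm !homeo_conjE fz.
Qed.

Lemma flip_flux0 f : topological_full_group phi f -> flux phi f point = 0%R ->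
  flux psi (homeo_conj L f) point = 0%R.
Proof.
move=> Tf f0; have TLf := flip_tfg Tf.
rewrite (flux_constant mpsi _ (L point) TLf).
have := flux_conj L phi f point; rewrite f0; case: flipL => -> //.
by rewrite flux_inv //; lia.
Qed.

End FlipConjugacy.

Lemma flip_sym (X Y : topologicalType) (phi : homeo_group X)
    (psi : homeo_group Y) (L : homeo X Y) :
    homeo_conj L phi = psi \/ homeo_conj L phi = psi^-1 ->
  homeo_conj (homeo_sym L) psi = phi \/ homeo_conj (homeo_sym L) psi = phi^-1.
Proof.
case=> E; [left|right]; first by rewrite -E homeo_conjK.
by apply: (can_inj invgK); rewrite -homeo_conjV -E homeo_conjK invgK.
Qed.

Theorem theorem5p13 (R : realType) (X1 X2 : pmetricType R)
    (phi1 : homeo_group X1) (phi2 : homeo_group X2)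
    (hphi1 : cantor_minimal phi1) (hphi2 : cantor_minimal phi2) :
  [/\ flip_conjugate phi1 phi2 <->
        subgroup_isomorphic
          (commutator_subgroup (topological_full_group phi1))
          (commutator_subgroup (topological_full_group phi2)),
      forall (mu1 : probability (borel X1) R) (mu2 : probability (borel X2) R),
        invariant_measure phi1 mu1 -> invariant_measure phi2 mu2 ->
        (flip_conjugate phi1 phi2 <->
         subgroup_isomorphic
           (topological_full_group0 phi1 mu1)
           (topological_full_group0 phi2 mu2))
    & flip_conjugate phi1 phi2 <->
        subgroup_isomorphic
          (topological_full_group phi1)
          (topological_full_group phi2)].
Proof.
have T1 := commutator_tfg_sub hphi1; have T2 := commutator_tfg_sub hphi2.
have s1 := tfg_subgroup hphi1; have s2 := tfg_subgroup hphi2.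
split.
- split=> [[L flipL]|].
    apply: (subgroup_isomorphic_conj (L := L)); apply: commutator_subgroup_conj.
      exact: flip_tfg flipL.
    exact: flip_tfg (flip_sym flipL).
  by apply: flip_conjugate_of_isomorphism; try exact: commutator_subgroup_subgroup.
- move=> mu1 mu2 inv1 inv2; split=> [[L flipL]|].
    apply: (subgroup_isomorphic_conj (L := L)) => f.
      move=> /(tfg0P hphi1 inv1)[Tf f0]; apply/(tfg0P hphi2 inv2).
      by split; [exact: flip_tfg flipL _ Tf|exact: flip_flux0 flipL _ Tf f0].
    move=> /(tfg0P hphi2 inv2)[Tf f0]; apply/(tfg0P hphi1 inv1).
    have flipL' := flip_sym flipL.
    by split; [exact: flip_tfg flipL' _ Tf|exact: flip_flux0 flipL' _ Tf f0].
  apply: flip_conjugate_of_isomorphism => //; try exact: tfg0_subgroup.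
  + exact: commutator_tfg_sub0.
  + by move=> f [].
  + exact: commutator_tfg_sub0.
  + by move=> f [].
- split=> [[L flipL]|].
    apply: (subgroup_isomorphic_conj (L := L)); first exact: flip_tfg flipL.
    exact: flip_tfg (flip_sym flipL).
  exact: flip_conjugate_of_isomorphism.
Qed.
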